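(* With probability tending to $1$ as $n\to\infty$, the uniform attachment graph $G_{n,5}$ has a perfect matching, where a perfect matching means a matching that isolates at most one vertex.
   Context: For positive integers $n,k$, the uniform attachment graph $G_{n,k}$ is the random graph on vertex set $[n]=\{1,\dots,n\}$ in which each vertex $j\in\{2,\dots,n\}$ makes $k$ choices uniformly and independently (with repetition allowed; choices of different vertices are also independent) from $\{1,\dots,j-1\}$ and is joined by an edge to each chosen vertex. Edge orientations and multiplicities are disregarded, so $G_{n,k}$ is a simple undirected graph. A matching $M$ isolates a vertex $v$ if $v$ is not incident to any edge of $M$. To accommodate odd $n$, a perfect matching is defined as a matching that isolates at most one vertex. *)

(* Defs.v *)
From HB Require Import structures.
From mathcomp Require Import all_boot all_order all_algebra.
From mathcomp Require Import all_classical all_reals all_analysis.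

Set Implicit Arguments.
Unset Strict Implicit.
Unset Printing Implicit Defensive.

Import Order.TTheory GRing.Theory Num.Theory.
Import numFieldNormedType.Exports.

Local Open Scope ring_scope.

Section Matching.
Variables (V : finType) (adj : rel V).

Definition edges : {set {set V}} :=
  [set e | [exists u, exists v, adj u v && (e == [set u; v])]].

Definition matching (M : {set {set V}}) : bool :=
  (M \subset edges) &&
  [forall e in M, forall f in M, (e != f) ==> [disjoint e & f]].

Definition isolates (M : {set {set V}}) (v : V) : bool :=
  [forall e in M, v \notin e].

Definition perfect_matching (M : {set {set V}}) : bool :=
  matching M && (#|[set v | isolates M v]| <= 1)%N.

Definition has_perfect_matching : bool := [exists M, perfect_matching M].

End Matching.

(* The vertices 1, ..., n are represented by 0, ..., n - 1 in 'I_n.  The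
   choosing vertices 1, ..., n - 1 are indexed by j : 'I_n.-1, the index j
   standing for the vertex j.+1; its k choices range over the j.+1 smaller
   vertices 0, ..., j, that is, over 'I_j.+1. *)
Definition ua_choices (n k : nat) : finType :=
  {dffun forall j : 'I_n.-1, {ffun 'I_k -> 'I_j.+1}}.

Definition ua_adj (n k : nat) (c : ua_choices n k) : rel 'I_n :=
  fun u v => [exists j : 'I_n.-1, exists i : 'I_k,
    ((u == j.+1 :> nat) && (v == c j i :> nat)) ||
    ((v == j.+1 :> nat) && (u == c j i :> nat))].

Lemma ua_adj_sym (n k : nat) (c : ua_choices n k) : symmetric (ua_adj c).
Proof.
by move=> u v; apply: eq_existsb => j; apply: eq_existsb => i; rewrite orbC.
Qed.

Lemma ua_adj_irr (n k : nat) (c : ua_choices n k) : irreflexive (ua_adj c).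
Proof.
move=> u; apply/existsP => -[j /existsP[i]]; rewrite orbb => /andP[/eqP uj /eqP uc].
by have := ltn_ord (c j i); rewrite -uc uj ltnn.
Qed.

Section Law.
Variable R : realType.

Definition uniform_mass (T : finType) (x : T) : R := #|T|%:R^-1.

(* Independence of all the choices: the joint law is the product law. *)
Definition ua_mass (n k : nat) (c : ua_choices n k) : R :=
  \prod_(j < n.-1) \prod_(i < k) uniform_mass (c j i).

Definition ua_prob (n k : nat) (A : pred (ua_choices n k)) : R :=
  \sum_(c | A c) ua_mass c.

Lemma ua_prob_total (n k : nat) : ua_prob (@predT (ua_choices n k)) = 1.
Proof.
rewrite /ua_prob (eq_bigr (fun=> \prod_(j < n.-1) (j.+1%:R^-1 ^+ k))); last first.
  move=> c _; apply: eq_bigr => j _.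
  by rewrite /uniform_mass card_ord prodr_const card_ord.
rewrite sumr_const card_dep_ffun /= foldrE big_map big_enum /=.
rewrite -mulr_natr natr_prod -big_split /= big1 // => j _.
by rewrite card_ffun !card_ord natrX -exprMn mulVf ?expr1n // pnatr_eq0.
Qed.

End Law.

(* Main.v *)
Require Import Defs.
From HB Require Import structures.
From mathcomp Require Import all_boot all_order all_algebra all_fingroup.
From mathcomp Require Import all_classical all_reals all_analysis.
From mathcomp Require Import zify ring lra.
From mathcomp Require Import fintype finset.

Set Implicit Arguments.
Unset Strict Implicit.
Unset Printing Implicit Defensive.

Import Order.TTheory GRing.Theory Num.Theory.
Import numFieldNormedType.Exports.

(** Why a perfect matching exists with high probability.

A graph with no perfect matching has an obstruction in the style of Gallai
and Edmonds: a set S whose removal leaves at least |S| + 2 classes of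
vertices, with no edges between distinct classes, such that in a class of
more than one vertex every vertex has two neighbours in its own class
([gallai_partition]).  The proof shows by first moments that uniform
attachment with five choices rarely produces such an obstruction.

The probabilistic input is nearly sharp.  Fix disjoint sets A and B of sizes a and b
and ask that every neighbour of A lie in A or B.  Multiplying, vertex after
vertex, the numbers of choices left, one finds that the product is largest
when B consists of the oldest vertices and that it then does not depend on
how A and the remaining vertices interleave.  This gives the bounds
('C(a + b, a) / 'C(n, a))^5 ([prob_closed]) and, if the neighbours of A must
all lie in B, ((b + 1)^a / n^_a)^5 ([prob_indep]).  Both follow by induction
on the number of vertices.

Let M be a large constant and m = n / M.  Four events are improbable:
- a small set A, of at most n / 16 vertices, with at most |A| - 1 outer
  neighbours ([prob_small_trap]);
- a set A of between n / 16 and n / 2 vertices with at most n / 512 outer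
  neighbours ([prob_medium_trap]);
- an independent set A, of linear size, whose neighbours lie in a set of size
  |A| + 3m ([prob_indep_trap]);
- at least m sets D of at most M vertices, containing none of the m oldest
  vertices, in which at least |D| choices stay inside D
  ([prob_many_cyclic]).
The third event is where five choices matter: apart from factors that are
small because m is a small fraction of n, the count at |A| = n / 2 is
beaten by the probability because 3 e^5 < 2^9 ([entropy_bound]).

If none of these events occurs, there is no obstruction
([no_perfect_matching_trap]).  When |S| >= n / 512, at most 3m classes have
more than one vertex: such a class contains one of the m oldest vertices, or
has more than M elements, or is one of the sets D above, because two
neighbours for each vertex force as many edges as vertices.  Hence at least
|S| - 3m classes are single vertices; they form an independent set with all
neighbours in S, which is the third event.  When |S| < n / 512, a largest
union of classes with at most n / 2 elements either has at least n / 4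
elements or misses only one class and so has more than |S| elements; its
outer neighbours lie in S, which is the first or the second event. *)

(** * Obstructions to perfect matchings *)

Section Gallai.
Variables (V : finType) (adj : rel V).
Hypothesis adjC : symmetric adj.
Hypothesis adjI : irreflexive adj.

(** A matching inside U, encoded as the involution that exchanges matched
    vertices and fixes the unmatched ones: symmetric differences of matchings
    become orbits of a composite of two involutions. *)
Definition pairing (U : {set V}) (f : {ffun V -> V}) : bool :=
  [forall v, [&& f (f v) == v, (f v != v) ==> adj v (f v)
    & (v \notin U) ==> (f v == v)]].

Definition missed (U : {set V}) (f : {ffun V -> V}) : {set V} :=
  [set v in U | f v == v].

Lemma pairingP (U : {set V}) (f : {ffun V -> V}) :
  reflect [/\ involutive f, forall v, f v != v -> adj v (f v)
    & forall v, v \notin U -> f v = v] (pairing U f).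
Proof.
apply: (iffP forallP) => [H|[H1 H2 H3] v].
  by split=> v; have /and3P[/eqP ? /implyP ? /implyP h3] := H v => //; move/h3/eqP.
by rewrite H1 eqxx /=; apply/andP; split; apply/implyP => /[dup] ? ; [move/H2|move/H3->].
Qed.

Lemma pairing_id U : pairing U (finfun id).
Proof. by apply/pairingP; split=> v; rewrite !ffunE // eqxx. Qed.

(** The matched vertices come in pairs, one of each pair preceding the other
    in the enumeration of V. *)
Lemma odd_missed (U : {set V}) (f : {ffun V -> V}) :
  pairing U f -> odd #|missed U f| = odd #|U|.
Proof.
case/pairingP => fK _ fU.
have fin v : f v != v -> v \in U by apply: contraNT => /fU ->.
have -> : #|U| = #|missed U f| + (#|[set v | enum_rank v < enum_rank (f v)]|
                          + #|[set v | enum_rank (f v) < enum_rank v]|).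
  rewrite -[LHS](cardsID (missed U f)); congr (_ + _).
    by apply: eq_card => v; rewrite !inE; case: (v \in U).
  rewrite -[LHS](cardsID [set v | enum_rank v < enum_rank (f v)]).
  have rk v : f v != v -> enum_rank (f v) != enum_rank v :> nat.
    by apply: contraNneq => /ord_inj /enum_rank_inj ->.
  congr (_ + _); apply: eq_card => v; rewrite !inE.
    case: ltnP; rewrite ?andbF ?andbT //= => lt.
    have ne : f v != v by apply: contraTneq lt => ->; rewrite ltnn.
    by rewrite (negbTE ne) (fin _ ne).
  case: (eqVneq (f v) v) => [->|ne]; first by rewrite !ltnn; case: (v \in U).
  by rewrite (fin _ ne) /= ?andbT -leqNgt leq_eqVlt (negbTE (rk _ ne)).
have -> : #|[set v | enum_rank (f v) < enum_rank v]|
        = #|[set v | enum_rank v < enum_rank (f v)]|.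
  rewrite -(card_imset _ (inv_inj fK)); apply: eq_card => v.
  apply/imsetP/idP => [[u] /[!inE] lt ->|/[!inE] lt]; first by rewrite fK.
  by exists (f v); rewrite ?inE fK.
by rewrite addnn oddD odd_double addbF.
Qed.

Definition optimal (U : {set V}) (f : {ffun V -> V}) : bool :=
  pairing U f && [forall g, pairing U g ==> (#|missed U f| <= #|missed U g|)].

Lemma optimalP U f :
  reflect (pairing U f /\ forall g, pairing U g -> #|missed U f| <= #|missed U g|)
    (optimal U f).
Proof.
apply: (iffP andP) => -[pf H]; split=> //.
  by move=> g pg; move/forallP/(_ g)/implyP: H; apply.
by apply/forallP => g; apply/implyP; exact: H.
Qed.

Lemma optimal_ex U : exists f, optimal U f.
Proof.
case: (arg_minnP (fun f => #|missed U f|) (pairing_id U)) => f pf H.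
by exists f; apply/optimalP.
Qed.

Definition critical (U : {set V}) :=
  forall v, v \in U -> exists2 f, optimal U f & f v = v.

(** Delete, as long as there is one, a vertex covered by all optimal
    pairings.  Each deletion increases the number of missed vertices by at
    least one: it cannot stay the same by parity, and it cannot decrease
    because an optimal pairing never misses the deleted vertex. *)
Lemma critical_ex U f : optimal U f ->
  exists S : {set V}, [/\ S \subset U, critical (U :\: S)
    & forall g, pairing (U :\: S) g -> #|S| + #|missed U f| <= #|missed (U :\: S) g|].
Proof.
elim: {U}_.+1 {-2}U (ltnSn #|U|) f => // N IH U leUN f fo.
case: (boolP [forall v in U, [exists g, optimal U g && (g v == v)]]) => [/forall_inP H|].
  exists set0; rewrite sub0set setD0; split=> // [v /H/existsP[g /andP[? /eqP ?]]|g pg].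
    by exists g.
  by rewrite cards0; case/optimalP: fo => _; apply.
rewrite negb_forall_in => /exists_inP[v vU /existsPn nov].
have U'lt : #|U :\ v| < N by move: leUN; rewrite (cardsD1 v U) vU.
have [h ho] := optimal_ex (U :\ v).
have [S [SU crS HS]] := IH _ U'lt h ho.
have US : U :\ v :\: S = U :\: (v |: S) by rewrite setDDl.
have vS : v \notin S by apply/negP => /(subsetP SU); rewrite !inE eqxx.
exists (v |: S); split.
- by rewrite subUset sub1set vU (subset_trans SU) // subD1set.
- by rewrite -US.
move=> g; rewrite -US => /HS; apply: leq_trans.
rewrite cardsU1 vS /= -addnA addnCA leq_add2l.
case/optimalP: ho => hp hmin; case/optimalP: fo => fp fmin.
have [hK hadj hU] := pairingP _ _ hp.
have hpU : pairing U h.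
  by apply/pairingP; split=> // u uU; apply: hU; rewrite !inE (negbTE uU) andbF.
have hv : h v = v by apply: hU; rewrite !inE eqxx.
have mh : #|missed U h| = #|missed (U :\ v) h|.+1.
  rewrite (cardsD1 v) inE vU hv eqxx add1n; congr _.+1; apply: eq_card => u.
  by rewrite !inE andbA.
have := fmin _ hpU; rewrite leq_eqVlt => /orP[/eqP E|].
  have := nov h; rewrite hv eqxx andbT; case/negP.
  by apply/optimalP; split=> // g' /fmin; rewrite E.
(* As a pairing of U, h misses strictly more vertices than f, hence at least
   two more by parity; one of them is v. *)
have := odd_missed hpU; rewrite -(odd_missed fp) mh /= => par.
rewrite ltnS leq_eqVlt => /orP[/eqP E|//].
by move: par; rewrite E; case: (odd _).
Qed.

(** In a critical set this relation is an equivalence, by Gallai's lemma; its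
    classes are the components of the Gallai-Edmonds decomposition. *)
Definition linked (U : {set V}) (u v : V) : bool :=
  (u == v) || [forall f, optimal U f ==> ~~ ((f u == u) && (f v == v))].

Lemma linkedP U u v : reflect (u = v \/ forall f, optimal U f -> f u = u -> f v = v -> False)
  (linked U u v).
Proof.
apply: (iffP orP) => -[/eqP|H]; try by left.
  right=> f fo fu fv; move/forallP/(_ f)/implyP/(_ fo): H.
  by rewrite fu fv !eqxx.
right; apply/forallP => f; apply/implyP => fo; apply/negP => /andP[/eqP ? /eqP ?].
exact: H fo _ _.
Qed.

Lemma linked_sym U : symmetric (linked U).
Proof.
by move=> u v; rewrite /linked eq_sym; congr orb; apply: eq_forallb => f; rewrite andbC.
Qed.

Lemma adj_linked (U : {set V}) u v : u \in U -> v \in U -> adj u v -> linked U u v.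
Proof.
move=> uU vU uv; apply/linkedP; right=> f /optimalP[fp fmin] fu fv.
have [fK fadj fU] := pairingP _ _ fp.
have neq : u != v by apply: contraTneq uv => ->; rewrite adjI.
have nfu w : w != u -> f w != u by apply: contraNneq => E; rewrite -(fK w) E fu.
have nfv w : w != v -> f w != v by apply: contraNneq => E; rewrite -(fK w) E fv.
pose g := [ffun w => if w == u then v else if w == v then u else f w].
have gp : pairing U g.
  apply/pairingP; split=> w; rewrite !ffunE.
  - case: (eqVneq w u) => [->|wu]; first by rewrite eq_sym (negbTE neq) eqxx.
    case: (eqVneq w v) => [->|wv]; first by rewrite eqxx.
    by rewrite (negbTE (nfu _ wu)) (negbTE (nfv _ wv)) fK.
  - case: (eqVneq w u) => [->//|wu]; case: (eqVneq w v) => [->|wv]; last exact: fadj.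
    by rewrite adjC.
  case: (eqVneq w u) => [->|wu]; first by rewrite uU.
  by case: (eqVneq w v) => [->|wv]; [rewrite vU | exact: fU].
have := fmin _ gp; rewrite leqNgt => /negP; apply; apply: proper_card.
apply/properP; split.
  apply/subsetP => w; rewrite !inE !ffunE => /andP[-> /=].
  case: (eqVneq w u) => [->|wu]; first by rewrite eq_sym (negbTE neq).
  by case: (eqVneq w v) => [->|wv //]; rewrite (negbTE neq).
by exists u; rewrite !inE uU ?fu ?eqxx // ffunE eqxx eq_sym (negbTE neq).
Qed.

Lemma splice_pairing U (f g : {ffun V -> V}) (P : {set V}) : pairing U f -> pairing U g ->
  (forall v, (f v \in P) = (v \in P)) -> (forall v, (g v \in P) = (v \in P)) ->
  pairing U [ffun v => if v \in P then g v else f v].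
Proof.
move=> /pairingP[fK fadj fU] /pairingP[gK gadj gU] fP gP; apply/pairingP.
split=> v; rewrite !ffunE.
- by case: (boolP (v \in P)) => vP; rewrite ?gP ?fP ?vP ?(negbTE vP) ?gK ?fK.
- by case: ifP => _; [exact: gadj | exact: fadj].
- by case: ifP => _; [exact: gU | exact: fU].
Qed.

Lemma card_splice U (f g : {ffun V -> V}) (P : {set V}) :
  #|missed U [ffun v => if v \in P then g v else f v]|
  = #|missed U g :&: P| + #|missed U f :\: P|.
Proof.
rewrite -[LHS](cardsID P); congr (_ + _); apply: eq_card => v; rewrite !inE !ffunE.
  by case: (v \in P); rewrite ?andbF.
by case: (v \in P); rewrite ?andbF.
Qed.

(** Exchanging f and g on P preserves the total number of missed vertices of
    the two pairings, so that neither can become better than the optimum. *)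
Lemma splice_optimal U (f g : {ffun V -> V}) (P : {set V}) : optimal U f -> optimal U g ->
  (forall v, (f v \in P) = (v \in P)) -> (forall v, (g v \in P) = (v \in P)) ->
  optimal U [ffun v => if v \in P then g v else f v].
Proof.
move=> /optimalP[fp fmin] /optimalP[gp gmin] fP gP.
apply/optimalP; split; first exact: splice_pairing.
move=> h /fmin; apply: leq_trans.
have := gmin _ (splice_pairing gp fp gP fP).
rewrite !card_splice -(cardsID P (missed U f)) -(cardsID P (missed U g)); lia.
Qed.

(** P is the alternating path of f and g that starts at t.  It is the orbit of
    t under h = g o f; there f acts as k |-> -k-1 and g as k |-> -k on the
    exponents, so that each fixed point of f gives an odd power of h that
    fixes t. *)
Lemma alternating_path (f g : V -> V) t : involutive f -> involutive g -> g t = t ->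
  exists P : {set V}, [/\ t \in P, forall v, (f v \in P) = (v \in P),
    forall v, (g v \in P) = (v \in P)
    & {in P &, forall u v, f u = u -> f v = v -> u = v}].
Proof.
move=> fK gK gt.
have hI : injective (g \o f) by apply: inj_comp; exact: inv_inj.
pose h : {perm V} := perm hI.
have hE v : h v = g (f v) by rewrite permE.
have hVE v : (h^-1)%g v = f (g v).
  by apply: (@perm_inj _ h); rewrite permKV hE fK gK.
have fh (x : V) : f (h x) = (h^-1)%g (f x) by rewrite hE hVE.
have gh (x : V) : g (h x) = (h^-1)%g (g x) by rewrite hE hVE !gK.
have fhn k x : f ((h ^+ k)%g x) = (h ^- k)%g (f x).
  elim: k x => [|k IH] x; first by rewrite !expg0 invg1 !perm1.
  by rewrite [in LHS]expgSr permM fh IH expgS invMg permM.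
have ghn k x : g ((h ^+ k)%g x) = (h ^- k)%g (g x).
  elim: k x => [|k IH] x; first by rewrite !expg0 invg1 !perm1.
  by rewrite [in LHS]expgSr permM gh IH expgS invMg permM.
have ft : f t = (h^-1)%g t by rewrite hVE gt.
have inO (s : {perm V}) : s \in <[h]>%g -> s t \in porbit h t.
  by case/cycleP => q ->; exact: mem_porbit.
have closed (F : V -> V) : involutive F -> (forall v, v \in porbit h t -> F v \in porbit h t) ->
    forall v, (F v \in porbit h t) = (v \in porbit h t).
  by move=> FK HF v; apply/idP/idP => /HF //; rewrite FK.
exists (porbit h t); split.
- exact: porbit_id.
- apply: (closed _ fK) => v /porbitP[k ->]; rewrite fhn ft -permM.
  by apply: inO; rewrite groupM // groupV ?mem_cycle ?cycle_id.
- apply: (closed _ gK) => v /porbitP[k ->]; rewrite ghn gt.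
  by apply: inO; rewrite groupV mem_cycle.
move=> u v /porbitP[k ->] /porbitP[l ->]; rewrite !fhn ft.
have key q : (h ^- q)%g ((h^-1)%g t) = (h ^+ q)%g t -> (h ^+ (q.*2.+1))%g t = t.
  move/(congr1 (h ^+ q)%g); rewrite permKV -permM -expgD addnn => /(congr1 h).
  by rewrite permKV -permM -expgSr => /esym.
move=> /key Hk /key Hl.
wlog le_kl : k l Hk Hl / k <= l.
  by move=> H; case: (leqP k l) => [/H->//|/ltnW /H E]; apply/esym/E.
(* h ^+ (2k+1) and h ^+ (2l+1) both fix t, so h ^+ (2 (l-k)) fixes t; as 2k+1
   is odd, so does h ^+ (l-k). *)
have mul q r : (h ^+ q)%g t = t -> (h ^+ (q * r))%g t = t.
  move=> hq; elim: r => [|r IH]; first by rewrite muln0 expg0 perm1.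
  by rewrite mulnS expgD permM hq IH.
have sub q r : (h ^+ (q + r))%g t = t -> (h ^+ q)%g t = t -> (h ^+ r)%g t = t.
  by rewrite expgD permM => E1 E2; rewrite E2 in E1.
have H2 : (h ^+ ((l - k).*2))%g t = t.
  by apply: (sub k.*2.+1) => //; rewrite (_ : _ + _ = l.*2.+1) //; lia.
have H1 : (h ^+ (l - k))%g t = t.
  apply: (sub ((l - k).*2 * k)); last exact: mul.
  by rewrite (_ : _ + _ = k.*2.+1 * (l - k)); [exact: mul | lia].
by rewrite -(subnK le_kl) expgD permM H1.
Qed.

(** Gallai's lemma.  If an optimal f misses u and v, take an optimal g that
    misses t and replace f by g on the alternating path from t.  The path
    contains at most one of u and v, so that the new optimal pairing misses t
    together with u or v. *)
Lemma linked_trans (U : {set V}) : critical U -> {in U & &, transitive (linked U)}.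
Proof.
move=> crU t u v tU uU vU ut tv; apply/linkedP.
case: (eqVneq u v) => [|uv]; [by left | right].
case: (eqVneq u t) ut => [ut _|nut ut] f fo fu fv.
  by case/linkedP: tv => [tv|/(_ f fo)]; [move: uv; rewrite ut tv eqxx | rewrite -ut => /(_ fu fv)].
case: (eqVneq t v) tv => [tv _|ntv tv].
  by case/linkedP: ut => [/eqP|/(_ f fo)]; [rewrite (negbTE nut) | rewrite tv => /(_ fu fv)].
have [g go gt] := crU t tU.
have [fp _] := optimalP _ _ fo; have [fK _ _] := pairingP _ _ fp.
have [gp _] := optimalP _ _ go; have [gK _ _] := pairingP _ _ gp.
have [P [tP fP gP uniqP]] := alternating_path fK gK gt.
have ho := splice_optimal fo go fP gP.
set h := finfun _ in ho.
have ht : h t = t by rewrite ffunE tP.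
have [uP|uP] := boolP (u \in P); last first.
  case/linkedP: ut => [/eqP|/(_ h ho)]; first by rewrite (negbTE nut).
  by apply=> //; rewrite ffunE (negbTE uP).
have vP : v \notin P by apply: contra_neqN uv => vP; exact: uniqP.
case/linkedP: tv => [/eqP|/(_ h ho)]; first by rewrite (negbTE ntv).
by apply=> //; rewrite ffunE (negbTE vP).
Qed.

(** An optimal pairing that misses u matches v to some x; one that misses x
    matches v to another vertex.  Both partners are linked to v. *)
Lemma two_neighbours (U : {set V}) u v : critical U -> u \in U -> v \in U -> u != v ->
  linked U u v -> exists x y, [/\ x != y, x \in U, y \in U, linked U v x && linked U v y
    & adj v x && adj v y].
Proof.
move=> crU uU vU nuv /linkedP[/eqP|uv]; first by rewrite (negbTE nuv).
have nbr f : optimal U f -> f v != v -> [/\ f v \in U, linked U v (f v) & adj v (f v)].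
  move=> fo fv; have [/pairingP[fK fadj fU] _] := optimalP _ _ fo.
  have fvU : f v \in U.
    by apply/negPn/negP => /fU; rewrite fK => E; move: fv; rewrite -E eqxx.
  by split=> //; [apply: adj_linked => //|]; apply: fadj.
have [f fo fu] := crU u uU.
have fv : f v != v by apply/eqP; exact: uv.
have [xU vx ax] := nbr f fo fv.
have [g go gx] := crU _ xU.
have gv : g v != v.
  case/linkedP: vx => [E|H]; first by move: fv; rewrite -E eqxx.
  by apply/eqP => gv; exact: (H g go).
have [yU vy ay] := nbr g go gv.
exists (f v), (g v); rewrite vx vy ax ay; split=> //.
apply: contraNneq fv => E; have [/pairingP[gK _ _] _] := optimalP _ _ go.
by rewrite -[X in _ == X]gK -E gx.
Qed.

Lemma perfect_matching_of_pairing (f : {ffun V -> V}) : pairing [set: V] f ->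
  #|missed [set: V] f| <= 1 -> has_perfect_matching adj.
Proof.
case/pairingP => fK fadj _ mf.
apply/existsP; exists [set [set v; f v] | v in [set v | f v != v]].
have memE w v : w \in [set v; f v] -> [set v; f v] = [set w; f w].
  by rewrite !inE => /orP[/eqP->//|/eqP->]; rewrite fK setUC.
apply/andP; split; first (apply/andP; split).
- apply/subsetP => e /imsetP[v /[!inE] fv ->].
  apply/existsP; exists v; apply/existsP; exists (f v).
  by rewrite fadj //= eqxx.
- apply/forall_inP => e /imsetP[v _ ->]; apply/forall_inP => e' /imsetP[w _ ->].
  apply/implyP; apply: contraR; rewrite -setI_eq0 => /set0Pn[x /setIP[xv xw]].
  by rewrite (memE _ _ xv) (memE _ _ xw).
apply: leq_trans mf; apply: subset_leq_card; apply/subsetP => v; rewrite !inE.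
apply: contraLR => fv; apply/forall_inPn; exists [set v; f v].
  by apply: imset_f; rewrite inE.
by rewrite negbK !inE eqxx.
Qed.

(** The classes of [linked] outside the set S of [critical_ex].  An optimal
    pairing of the complement of S misses at least |S| + 2 vertices, and no
    two of them are linked. *)
Theorem gallai_partition : ~~ has_perfect_matching adj ->
  exists (S : {set V}) (P : {set {set V}}), [/\ partition P (~: S), #|S| + 2 <= #|P|,
    forall D u v, D \in P -> u \in D -> v \notin S -> adj u v -> v \in D
  & forall D v, D \in P -> 1 < #|D| -> v \in D ->
      exists x y, [/\ x != y, x \in D, y \in D & adj v x && adj v y]].
Proof.
move=> noPM.
have [f fo] := optimal_ex [set: V].
have mf : 1 < #|missed [set: V] f|.
  rewrite ltnNge; apply: contra noPM; apply: perfect_matching_of_pairing.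
  by case/optimalP: fo.
have [S [_ crS HS]] := critical_ex fo.
rewrite setTD in crS HS; set U := ~: S in crS HS.
have eqv : {in U & &, equivalence_rel (linked U)}.
  move=> x y z xU yU zU; split; first by rewrite /linked eqxx.
  move=> xy; apply/idP/idP => H.
    by apply: (linked_trans crS xU) => //; rewrite linked_sym.
  exact: (linked_trans crS yU) H.
have partP := equivalence_partitionP eqv.
set P := equivalence_partition _ _ in partP *.
have [covP trivP _] := and3P partP.
have inU D x : D \in P -> x \in D -> x \in U.
  by move=> DP xD; rewrite -(eqP covP); apply/bigcupP; exists D.
have same D x y : D \in P -> x \in D -> y \in U -> (y \in D) = linked U x y.
  move=> DP xD yU; rewrite -(def_pblock trivP DP xD).
  by apply: pblock_equivalence_partition => //; exact: inU xD.
exists S, P; split=> //.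
- have [g go] := optimal_ex U; have [gp _] := optimalP _ _ go.
  apply: leq_trans (leq_trans (HS _ gp) _); first by rewrite leq_add2l.
  rewrite -(@card_in_imset _ _ (pblock P)) => [|u v].
    apply: subset_leq_card; apply/subsetP => _ /imsetP[v /[!inE] /andP[vU _] ->].
    by apply: pblock_mem; rewrite (eqP covP) inE.
  rewrite !inE => /andP[uU /eqP gu] /andP[vU /eqP gv] E.
  have : v \in pblock P u by rewrite E mem_pblock (eqP covP) inE.
  rewrite pblock_equivalence_partition ?inE // => /linkedP[//|/(_ g go)].
  by case.
- move=> D u v DP uD vS uv; have uU := inU _ _ DP uD.
  have vU : v \in U by rewrite inE.
  by rewrite (same _ _ _ DP uD vU) adj_linked.
move=> D v DP D1 vD; have vU := inU _ _ DP vD.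
have [u uD nuv] : exists2 u, u \in D & u != v.
  move: D1; rewrite (cardsD1 v) vD ltnS card_gt0 => /set0Pn[u /setD1P[? ?]].
  by exists u.
have uU := inU _ _ DP uD.
have := two_neighbours crS uU vU nuv.
rewrite -(same _ _ _ DP uD vU) vD => /(_ isT)[x [y [xy xU yU /andP[vx vy] axy]]].
by exists x, y; rewrite !(same _ _ _ DP vD).
Qed.
End Gallai.

(** * Probabilities of neighbourhood constraints *)

Section Counting.
Local Open Scope nat_scope.

Definition below (a : pred nat) (v : nat) : nat := \sum_(x < v) (a x : nat).

Lemma belowS a v : below a v.+1 = below a v + a v.
Proof. by rewrite /below big_ord_recr. Qed.

Lemma below_disjoint a b v : (forall x, ~~ (a x && b x)) -> below a v + below b v <= v.
Proof.
move=> dis; elim: v => [|v IH]; first by rewrite /below !big_ord0.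
by rewrite !belowS; move: (dis v); case: (a v); case: (b v) => //=; lia.
Qed.

(** The number of admissible choices of the vertex v when vertices of a have x
    admissible choices, vertices of b are free, and the other ones must avoid
    a. *)
Definition weight (a : pred nat) (x : nat) (b : bool) (v : nat) : nat :=
  if a v then x else if b then v else v - below a v.

(** Induction on the last vertex.  In each of the three cases the recurrences
    of the binomial coefficients turn the claim into a polynomial inequality
    that follows from A + B <= n.  For a vertex of a, or of neither set, both
    sides agree up to lower order terms: only the vertices of b lose, and
    they lose nothing when they are the oldest ones. *)
Lemma closed_weight_prod (a b : pred nat) (N : nat) : (forall x, ~~ (a x && b x)) ->
  let A := below a N.+1 in let B := below b N.+1 in
  \prod_(j < N) weight a (below a j.+1 + below b j.+1) (b j.+1) j.+1 * 'C(N.+1, A)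
    <= N`! * 'C(A + B, A).
Proof.
move=> dis; elim: N => [|N IH] /=.
  rewrite big_ord0 !mul1n !belowS /below !big_ord0 !add0n.
  by move: (dis 0); case: (a 0); case: (b 0).
rewrite big_ord_recr /= {2}/weight ![below _ N.+2]belowS.
move: (below_disjoint N.+1 dis) (dis N.+1) IH; rewrite /=.
move: (\prod_(j < N) _) (below a N.+1) (below b N.+1) => W A B.
have -> : (N.+1)`! = N.+1 * N`! by rewrite factS.
set n := N.+1; move: (N`!) => F.
case: (a n); case: (b n) => //= leAB _ IH; rewrite ?addn0 ?addn1.
- rewrite -(leq_pmul2l (ltn0Sn A)).
  have E1 := mul_bin_diag n.+1 A; have E2 := mul_bin_diag (A + B).+1 A.
  rewrite /= in E1 E2; rewrite addSn.
  have -> : A.+1 * (W * (A + B) * 'C(n.+1, A.+1)) = ((A + B) * n.+1) * (W * 'C(n, A)).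
    by rewrite mulnCA -E1; ring.
  have -> : A.+1 * (n * F * 'C((A + B).+1, A.+1)) = (n * (A + B).+1) * (F * 'C(A + B, A)).
    by rewrite mulnCA -E2; ring.
  by apply: leq_mul => //; nia.
- have An : 0 < n.+1 - A by lia.
  have B1 : 0 < B.+1 by [].
  rewrite -(leq_pmul2l An) -(leq_pmul2l B1).
  have E1 := mul_bin_down n.+1 A; have E2 := mul_bin_down (A + B).+1 A.
  rewrite /= (_ : (A + B).+1 - A = B.+1) in E1 E2; last by lia.
  rewrite addnS.
  have -> : B.+1 * ((n.+1 - A) * (W * n * 'C(n.+1, A))) = n * (n.+1 * B.+1) * (W * 'C(n, A)).
    by rewrite (mulnCA (n.+1 - A)) -E1; ring.
  have -> : B.+1 * ((n.+1 - A) * (n * F * 'C((A + B).+1, A)))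
     = n * ((n.+1 - A) * (A + B).+1) * (F * 'C(A + B, A)).
    by rewrite mulnCA [B.+1 * _]mulnCA -E2; ring.
  have K : n.+1 * B.+1 <= (n.+1 - A) * (A + B).+1.
    have : n.+1 = (n.+1 - A) + A by lia.
    have : B.+1 <= n.+1 - A by lia.
    by move: (n.+1 - A) => d hd ->; nia.
  by rewrite -!(mulnA n) leq_mul2l; apply/orP; right; exact: leq_mul.
have An : 0 < n.+1 - A by lia.
rewrite -(leq_pmul2l An).
have E1 := mul_bin_down n.+1 A; rewrite /= in E1.
have -> : (n.+1 - A) * (W * (n - A) * 'C(n.+1, A)) = ((n - A) * n.+1) * (W * 'C(n, A)).
  by rewrite mulnCA -E1; ring.
have -> : (n.+1 - A) * (n * F * 'C(A + B, A)) = (n * (n.+1 - A)) * (F * 'C(A + B, A)) by ring.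
by apply: leq_mul => //; nia.
Qed.

Lemma bernoulli_shift d x i : x <= d -> (d + i) * x ^ i <= d * x.+1 ^ i.
Proof.
move=> xd; elim: i => [|i IH]; first by rewrite addn0 !expn0.
rewrite !expnS; have h : x ^ i <= x.+1 ^ i by case: i {IH} => // i; rewrite leq_exp2r.
by move: (x ^ i) (x.+1 ^ i) IH h => u v IH h; nia.
Qed.

(** The same induction as for [closed_weight_prod].  With B in place of B.+1
    the step for a vertex of a would fail by a factor (n + 1) / n. *)
Lemma indep_weight_prod (a b : pred nat) (N : nat) : (forall x, ~~ (a x && b x)) ->
  let A := below a N.+1 in let B := below b N.+1 in
  \prod_(j < N) weight a (below b j.+1) (b j.+1) j.+1 * (N.+1 ^_ A)
    <= N`! * B.+1 ^ A.
Proof.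
move=> dis; elim: N => [|N IH] /=.
  rewrite big_ord0 !mul1n !belowS /below !big_ord0 !add0n.
  by move: (dis 0); case: (a 0); case: (b 0).
rewrite big_ord_recr /= {2}/weight ![below _ N.+2]belowS.
move: (below_disjoint N.+1 dis) (dis N.+1) IH; rewrite /=.
move: (\prod_(j < N) _) (below a N.+1) (below b N.+1) => W A B.
have -> : (N.+1)`! = N.+1 * N`! by rewrite factS.
set n := N.+1; move: (N`!) => F.
have E : n.+1 ^_ A * (n.+1 - A) = n.+1 * n ^_ A by rewrite -ffactnSr ffactSS.
case: (a n); case: (b n) => //= leAB _ IH; rewrite ?addn0 ?addn1.
- rewrite ffactSS expnS.
  have -> : W * B * (n.+1 * n ^_ A) = (B * n.+1) * (W * n ^_ A) by ring.
  have -> : n * F * (B.+1 * B.+1 ^ A) = (n * B.+1) * (F * B.+1 ^ A) by ring.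
  by apply: leq_mul => //; nia.
- have An : 0 < n.+1 - A by lia.
  rewrite -(leq_pmul2r An) -mulnA E.
  have /bernoulli_shift - /(_ A) : B.+1 <= n.+1 - A by lia.
  rewrite subnK; last by lia.
  move: (B.+1 ^ A) (B.+2 ^ A) IH => u v IH h.
  have -> : W * n * (n.+1 * n ^_ A) = n * n.+1 * (W * n ^_ A) by ring.
  apply: leq_trans (_ : n * n.+1 * (F * u) <= _); first by rewrite leq_mul2l IH orbT.
  have -> : n * n.+1 * (F * u) = n * F * (n.+1 * u) by ring.
  have -> : n * F * v * (n.+1 - A) = n * F * ((n.+1 - A) * v) by ring.
  by rewrite leq_mul2l h orbT.
have An : 0 < n.+1 - A by lia.
rewrite -(leq_pmul2r An) -mulnA E.
have -> : W * (n - A) * (n.+1 * n ^_ A) = ((n - A) * n.+1) * (W * n ^_ A) by ring.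
have -> : n * F * B.+1 ^ A * (n.+1 - A) = (n * (n.+1 - A)) * (F * B.+1 ^ A) by ring.
by apply: leq_mul => //; nia.
Qed.
End Counting.

Local Open Scope ring_scope.

Section Law.
Variable R : realType.

Lemma ua_mass_ge0 n k (c : ua_choices n k) : 0 <= ua_mass R c.
Proof. by apply: prodr_ge0 => j _; apply: prodr_ge0 => i _; rewrite invr_ge0 ler0n. Qed.

Lemma ua_prob_union n k (T : finType) (Q : pred T) (E : pred (ua_choices n k))
    (F : T -> pred (ua_choices n k)) :
  (forall c, E c -> exists2 x, Q x & F x c) ->
  ua_prob R E <= \sum_(x | Q x) ua_prob R (F x).
Proof.
move=> H; rewrite /ua_prob (eq_bigr (fun x => \sum_c (if F x c then ua_mass R c else 0)));
  last by move=> x _; rewrite big_mkcond.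
rewrite exchange_big big_mkcond; apply: ler_sum => c _.
have pos x : 0 <= (if F x c then ua_mass R c else 0).
  by case: ifP => // _; exact: ua_mass_ge0.
case: (boolP (E c)) => [/H[x Qx Fx]|_]; last exact: sumr_ge0.
by rewrite (bigD1 x Qx) /= Fx lerDl sumr_ge0.
Qed.

Lemma ua_prob_sub n k (E F : pred (ua_choices n k)) : (forall c, E c -> F c) ->
  ua_prob R E <= ua_prob R F.
Proof.
move=> H; rewrite /ua_prob big_mkcond [leRHS]big_mkcond; apply: ler_sum => c _.
case: (boolP (E c)) => [/H-> //|_]; case: ifP => // _; exact: ua_mass_ge0.
Qed.

(** The choices are uniform and independent, so the probability is the product
    of the fractions of admissible values. *)
Lemma ua_prob_slots n k (Al : forall j : 'I_n.-1, 'I_k -> {pred 'I_j.+1}) :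
  ua_prob R (fun c : ua_choices n k => [forall j, forall i, c j i \in Al j i])
  = \prod_(j < n.-1) \prod_(i < k) (#|Al j i|%:R / j.+1%:R).
Proof.
rewrite /ua_prob (eq_bigr (fun=> \prod_(j < n.-1) \prod_(i < k) (j.+1%:R^-1 : R))); last first.
  by move=> c _; apply: eq_bigr => j _; apply: eq_bigr => i _; rewrite /uniform_mass card_ord.
rewrite sumr_const.
have -> : #|[pred c : ua_choices n k | [forall j, forall i, c j i \in Al j i]]|
    = (\prod_(j < n.-1) \prod_(i < k) #|Al j i|)%N.
  transitivity #|(family (fun j : 'I_n.-1 => family (Al j)) : simpl_pred (ua_choices n k))|.
    by apply: eq_card => c; rewrite !inE.
  rewrite card_family foldrE big_map big_enum /=; apply: eq_bigr => j _.
  by rewrite card_family foldrE big_map big_enum.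
rewrite -mulr_natl natr_prod -big_split; apply: eq_bigr => j _ /=.
by rewrite natr_prod -big_split; apply: eq_bigr.
Qed.

(** Membership by value: the choices of different vertices are ordinals of
    different types. *)
Definition nmem n (A : {set 'I_n}) : pred nat := fun v => [exists u in A, u == v :> nat].

Lemma nmemE n (A : {set 'I_n}) (u : 'I_n) : nmem A u = (u \in A).
Proof.
apply/exists_inP/idP => [[w wA /eqP/ord_inj <-] //|uA]; by exists u.
Qed.

Lemma below_nmem n (A : {set 'I_n}) : below (nmem A) n = #|A|.
Proof.
rewrite /below -sum1_card [RHS]big_mkcond; apply: eq_bigr => u _.
by rewrite nmemE; case: (u \in A).
Qed.

Lemma card_below (a : pred nat) v : #|[pred x : 'I_v | a x]| = below a v.
Proof.
rewrite /below -sum1_card [LHS]big_mkcond; apply: eq_bigr => u _.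
by rewrite inE; case: (a u).
Qed.

Lemma below_nmem_le n (A : {set 'I_n}) v : (v <= n)%N -> (below (nmem A) v <= #|A|)%N.
Proof.
move=> vn; rewrite -below_nmem; move: (nmem A) => a; rewrite -(subnK vn).
elim: (n - v)%N => [|d IH] //.
by rewrite addSn belowS (leq_trans IH) // leq_addr.
Qed.

(** Taking X to be A :|: B says that only B bounds A from outside; taking X
    disjoint from A says moreover that A is independent. *)
Definition nbr_sub n k (c : ua_choices n k) (A X : {set 'I_n}) : bool :=
  [forall u in A, forall v, ua_adj c u v ==> (v \in X)].

Lemma choice_adj n k (c : ua_choices n k) (j : 'I_n.-1) (i : 'I_k) (u v : 'I_n) :
  u = j.+1 :> nat -> v = c j i :> nat -> ua_adj c u v.
Proof.
by move=> uj vc; apply/existsP; exists j; apply/existsP; exists i; rewrite uj vc !eqxx.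
Qed.

Lemma younger_lt n (j : 'I_n.-1) : (j.+1 < n)%N.
Proof. by case: n j => [|n] j; [case: j | case: j]. Qed.

Definition younger n (j : 'I_n.-1) : 'I_n := Ordinal (younger_lt j).

Lemma older_lt n k (c : ua_choices n k) (j : 'I_n.-1) (i : 'I_k) : (c j i < n)%N.
Proof. exact: leq_trans (ltn_ord _) (ltnW (younger_lt j)). Qed.

Definition older n k (c : ua_choices n k) (j : 'I_n.-1) (i : 'I_k) : 'I_n :=
  Ordinal (older_lt c j i).

Lemma younger_older n k (c : ua_choices n k) j i : ua_adj c (younger j) (older c j i).
Proof. exact: choice_adj. Qed.

(** A vertex of A may only choose in X, and a vertex outside A and X may not
    choose in A. *)
Lemma prob_nbr_sub n k (A X : {set 'I_n}) :
  ua_prob R (fun c : ua_choices n k => nbr_sub c A X)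
  <= ((\prod_(j < n.-1) weight (nmem A) (below (nmem X) j.+1) (nmem X j.+1) j.+1)%N%:R
       / (n.-1)`!%:R) ^+ k.
Proof.
pose Al (j : 'I_n.-1) (i : 'I_k) : {pred 'I_j.+1} := [pred x : 'I_j.+1 |
  if nmem A j.+1 then nmem X x else if nmem X j.+1 then true else ~~ nmem A x].
apply: le_trans (_ : ua_prob R (fun c : ua_choices n k =>
    [forall j, forall i, c j i \in Al j i]) <= _).
  apply: ua_prob_sub => c cAX; apply/forallP => j; apply/forallP => i; rewrite inE.
  have ad := younger_older c j i.
  have {1}-> : j.+1 = younger j :> nat by [].
  have -> : nmem X j.+1 = nmem X (younger j) by [].
  have -> : c j i = older c j i :> nat by [].
  rewrite !nmemE; case: ifP => yA.
    by move/forall_inP: cAX => /(_ _ yA) /forallP /(_ (older c j i)); rewrite ad.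
  case: ifP => // yX; apply: contraFN yX => oA.
  move/forall_inP: cAX => /(_ _ oA) /forallP /(_ (younger j)).
  by rewrite ua_adj_sym ad.
rewrite ua_prob_slots.
have -> : ((n.-1)`!)%:R = \prod_(j < n.-1) (j.+1%:R : R).
  by rewrite fact_prod natr_prod big_add1 big_mkord.
rewrite natr_prod -prodf_div -prodrXl; apply: ler_prod => j _; apply/andP; split.
  by apply: prodr_ge0 => i _; rewrite divr_ge0 ?ler0n.
rewrite (eq_bigr (fun=> (weight (nmem A) (below (nmem X) j.+1) (nmem X j.+1) j.+1)%:R
   / j.+1%:R)).
  by rewrite prodr_const card_ord.
move=> i _; congr (_%:R / _); rewrite /weight /Al.
case: ifP => _; first by rewrite card_below.
case: ifP => _; first by rewrite (eq_card (B := predT)) // card_ord.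
rewrite -card_below -[X in (X - _)%N]card_ord.
rewrite -[X in (X - _)%N](cardC [pred x : 'I_j.+1 | nmem A x]).
by rewrite addKn; apply: eq_card => x; rewrite !inE.
Qed.

Lemma prob_closed n (A B : {set 'I_n}) : (0 < n)%N -> [disjoint A & B] ->
  ua_prob R (fun c : ua_choices n 5 => nbr_sub c A (A :|: B))
  <= ('C(#|A| + #|B|, #|A|)%:R / 'C(n, #|A|)%:R) ^+ 5.
Proof.
move=> n0 dAB; apply: le_trans (prob_nbr_sub _ _ _) _.
have dis x : ~~ (nmem A x && nmem B x).
  apply/negP => /andP[/exists_inP[u uA /eqP <-]]; rewrite nmemE.
  by apply/negP; rewrite (disjointFr dAB uA).
have nU x : nmem (A :|: B) x = nmem A x || nmem B x.
  apply/exists_inP/orP => [[u /setUP[uA|uB] ux]|[]/exists_inP[u uu ux]].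
  - by left; apply/exists_inP; exists u.
  - by right; apply/exists_inP; exists u.
  - by exists u => //; rewrite inE uu.
  - by exists u => //; rewrite inE uu orbT.
have bU v : below (nmem (A :|: B)) v = (below (nmem A) v + below (nmem B) v)%N.
  rewrite /below -big_split; apply: eq_bigr => x _ /=; rewrite nU.
  by move: (dis x); case: (nmem A x); case: (nmem B x).
have := closed_weight_prod n.-1 dis; rewrite /= prednK // !below_nmem => H.
have -> : (\prod_(j < n.-1)
      weight (nmem A) (below (nmem (A :|: B)) j.+1) (nmem (A :|: B) j.+1) j.+1
    = \prod_(j < n.-1)
      weight (nmem A) (below (nmem A) j.+1 + below (nmem B) j.+1) (nmem B j.+1) j.+1)%N.
  by apply: eq_bigr => j _; rewrite /weight bU nU; case: (nmem A j.+1).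
rewrite lerXn2r ?nnegrE ?divr_ge0 ?ler0n //.
have An : (#|A| <= n)%N by rewrite -[X in (_ <= X)%N]card_ord max_card.
rewrite ler_pdivrMr ?ltr0n ?fact_gt0 // mulrAC ler_pdivlMr ?ltr0n ?bin_gt0 //.
by rewrite -!natrM ler_nat [X in (_ <= X)%N]mulnC.
Qed.

Lemma prob_indep n (A S : {set 'I_n}) : (0 < n)%N -> [disjoint A & S] ->
  ua_prob R (fun c : ua_choices n 5 => nbr_sub c A S)
  <= ((#|S|.+1 ^ #|A|)%:R / (n ^_ #|A|)%:R) ^+ 5.
Proof.
move=> n0 dAB; apply: le_trans (prob_nbr_sub _ _ _) _.
have dis x : ~~ (nmem A x && nmem S x).
  apply/negP => /andP[/exists_inP[u uA /eqP <-]]; rewrite nmemE.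
  by apply/negP; rewrite (disjointFr dAB uA).
have := indep_weight_prod n.-1 dis; rewrite /= prednK // !below_nmem => H.
rewrite lerXn2r ?nnegrE ?divr_ge0 ?ler0n //.
have An : (#|A| <= n)%N by rewrite -[X in (_ <= X)%N]card_ord max_card.
rewrite ler_pdivrMr ?ltr0n ?fact_gt0 // mulrAC ler_pdivlMr ?ltr0n ?ffact_gt0 //.
by rewrite -!natrM ler_nat [X in (_ <= X)%N]mulnC.
Qed.

Definition inner_slots n k (c : ua_choices n k) (D : {set 'I_n}) : {set 'I_n.-1 * 'I_k} :=
  [set s | (younger s.1 \in D) && (older c s.1 s.2 \in D)].

Lemma prob_inner_slots n k (D : {set 'I_n}) (T : {set 'I_n.-1 * 'I_k}) (m : nat) :
  (0 < m)%N -> (forall s, s \in T -> (m <= s.1.+1)%N) ->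
  ua_prob R (fun c : ua_choices n k => T \subset inner_slots c D)
  <= (#|D|%:R / m%:R) ^+ #|T|.
Proof.
move=> m0 Tm.
pose Al (j : 'I_n.-1) (i : 'I_k) : {pred 'I_j.+1} := [pred x : 'I_j.+1 |
  ((j, i) \in T) ==> nmem D x].
apply: le_trans (_ : ua_prob R (fun c : ua_choices n k =>
    [forall j, forall i, c j i \in Al j i]) <= _).
  apply: ua_prob_sub => c /subsetP TD; apply/forallP => j; apply/forallP => i; rewrite inE.
  apply/implyP => /TD; rewrite inE => /andP[_] /=.
  by rewrite -nmemE.
rewrite ua_prob_slots (pair_bigA _ (fun j i => #|Al j i|%:R / j.+1%:R)) /=.
rewrite -prodr_const big_mkcond /= [leRHS]big_mkcond /=.
apply: ler_prod => -[j i] _; rewrite divr_ge0 ?ler0n //=.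
case: ifP => ji.
  have -> : #|Al j i| = below (nmem D) j.+1.
    by rewrite -card_below; apply: eq_card => x; rewrite !inE ji.
  apply: ler_pM; rewrite ?invr_ge0 ?ler0n //.
    by rewrite ler_nat below_nmem_le // ltnW // younger_lt.
  by rewrite lef_pV2 ?posrE ?ltr0n // ler_nat; exact: (Tm (j, i)).
rewrite (eq_card (B := predT)) ?card_ord ?divff ?pnatr_eq0 //.
by move=> x; rewrite !inE ji.
Qed.
End Law.

(** * Binomial estimates *)

Section Binomials.
Local Open Scope nat_scope.

Lemma bin_ge_pow n a : a <= n -> n ^ a <= 'C(n, a) * a ^ a.
Proof.
elim: a n => [|a IH] n an; first by rewrite bin0 !expn0.
case: n an => // n an; have {IH}IH := IH n an.
rewrite expnS (mulnC 'C(_, _)) expnSr -mulnA -mul_bin_diag mulnCA leq_mul2l /=.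
case: a an IH => [|a] an IH; first by rewrite !expn0 bin0.
have a0 : 0 < a.+1 ^ a.+1 by rewrite expn_gt0.
rewrite -(leq_pmul2r a0) -expnMn.
apply: leq_trans (_ : (n * a.+2) ^ a.+1 <= _); first by rewrite leq_exp2r //; nia.
rewrite expnMn; apply: leq_trans (leq_mul IH (leqnn _)) _; rewrite leq_eqVlt; apply/orP; left.
by apply/eqP; ring.
Qed.

(** One term of the binomial expansion; x and y are chosen so that it is close
    to the largest one. *)
Lemma bin_tilt n s x y : s <= n -> 'C(n, s) * (x ^ (n - s) * y ^ s) <= (x + y) ^ n.
Proof.
by move=> sn; rewrite expnDn (bigD1 (Ordinal (sn : s < n.+1))) //= leq_addr.
Qed.

Lemma bin_le_exp2 n s : 'C(n, s) <= 2 ^ n.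
Proof.
case: (leqP s n) => [sn|ns]; last by rewrite bin_small.
by have := bin_tilt 1 1 sn; rewrite !exp1n !muln1.
Qed.

Lemma bin_shift n i t q : n <= q * i -> 'C(n, i + t) <= 'C(n, i) * q ^ t.
Proof.
move=> ni; elim: t => [|t IH]; first by rewrite addn0 muln1.
rewrite addnS -(leq_pmul2l (ltn0Sn (i + t))) mul_bin_left expnS.
by move: (q ^ t) ('C(n, i + t)) ('C(n, i)) IH => A B C IH; nia.
Qed.

(** In the expansion of (i + (n - i))^n the term of index i is the largest of
    the n + 1 terms. *)
Lemma bin_max_term n i : i <= n ->
  n ^ n <= n.+1 * ('C(n, i) * (i ^ i * (n - i) ^ (n - i))).
Proof.
move=> iln; pose f t := 'C(n, t) * ((n - i) ^ (n - t) * i ^ t).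
have step t : t < n -> t.+1 * (n - i) * f t.+1 = (n - t) * i * f t.
  move=> tn; rewrite /f (_ : n - t = (n - t.+1).+1); last by lia.
  rewrite !expnS; have := mul_bin_left n t; rewrite (_ : n - t = (n - t.+1).+1); last by lia.
  move: ('C(n, t.+1)) ('C(n, t)) (n - t.+1) => A B q E.
  transitivity (t.+1 * A * ((n - i) * (n - i) ^ q * i * i ^ t)); first by ring.
  by rewrite E; ring.
have up d : d <= i -> f (i - d) <= f i.
  elim: d => [|d IH] di; first by rewrite subn0.
  apply: leq_trans (IH (ltnW di)).
  have := step (i - d.+1); rewrite (_ : (i - d.+1).+1 = i - d); last by lia.
  move=> /(_ ltac:(lia)) E.
  case: (posnP ((n - (i - d.+1)) * i)) => [z|p].
    by exfalso; move/eqP: z; rewrite muln_eq0; lia.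
  rewrite -(leq_pmul2l p) -E leq_mul2r; apply/orP; right; nia.
have down d : i + d <= n -> f (i + d) <= f i.
  elim: d => [|d IH] di; first by rewrite addn0.
  apply: leq_trans (IH _); last by lia.
  have := step (i + d); rewrite -addnS => /(_ ltac:(lia)) E.
  have p : 0 < (i + d.+1) * (n - i) by rewrite muln_gt0; lia.
  rewrite -(leq_pmul2l p) E leq_mul2r; apply/orP; right; nia.
rewrite -{1}(subnK iln) expnDn; apply: leq_trans (_ : \sum_(t < n.+1) f i <= _).
  apply: leq_sum => t _; rewrite -/(f t); have tn := ltn_ord t.
  case: (leqP t i) => ti; first by rewrite -(subKn ti) up // leq_subr.
  by rewrite -(subnKC (ltnW ti)) down //; lia.
by rewrite sum_nat_const card_ord /f (mulnC (i ^ i)).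
Qed.

Lemma pow_le_ffact x k : x ^ k.+1 <= (x + k) ^_ k.+1.
Proof.
elim: k => [|k IH]; first by rewrite expn1 addn0 ffactn1.
by rewrite addnS ffactSS expnS; apply: leq_mul => //; rewrite ltnW // ltnS leq_addr.
Qed.

Lemma pow6_le_exp2 m : m.+1 ^ 6 <= (64 * 720) * 2 ^ m.
Proof.
apply: leq_trans (pow_le_ffact _ _) _; rewrite -bin_ffact addSnnS.
have := bin_le_exp2 (m + 6) 6; rewrite expnD (_ : 6`! = 720) //.
by move: ('C(_, _)) (2 ^ m) => A B; rewrite (_ : 2 ^ 6 = 64) //; lia.
Qed.
End Binomials.

Local Open Scope ring_scope.
Section Estimates.
Variable R : realType.
Implicit Types (n a b i m : nat) (x y : R).

Definition euler : R := expR 1.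

Lemma euler_gt0 : 0 < euler. Proof. exact: expR_gt0. Qed.
Lemma euler_ge1 : 1 <= euler.
Proof. by rewrite /euler -[leLHS]expR0 ler_expR. Qed.

Lemma expR_nat n : expR (n%:R : R) = euler ^+ n.
Proof. by rewrite -expRM_natl mulr1. Qed.

(** From e^(-1/64) >= 63/64 and six squarings with rational upper bounds. *)
Lemma euler_le : euler <= 11 / 4.
Proof.
have E : euler = expR (64%:R^-1) ^+ 64 by rewrite -expRM_natl divff ?pnatr_eq0.
have h : expR (64%:R^-1 : R) <= 64 / 63.
  have H : 63 / 64 <= expR (- 64%:R^-1 : R) by apply: le_trans (expR_ge1Dx _); lra.
  have p := expR_gt0 (64%:R^-1 : R).
  rewrite expRN in H.
  rewrite -(ler_pM2r (_ : 0 < 63 / 64)); last by lra.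
  apply: le_trans (ler_wpM2l (ltW p) H) _; rewrite divff ?gt_eqF //; lra.
have sq (z c d : R) : 0 <= z -> z <= c -> c ^+ 2 <= d -> 0 <= z ^+ 2 /\ z ^+ 2 <= d.
  move=> z0 zc cd; split; first exact: exprn_ge0.
  by apply: le_trans cd; rewrite lerXn2r ?nnegrE //; exact: le_trans zc.
have := expR_ge0 (64%:R^-1 : R); rewrite E.
move: (expR _) h => z h h0; rewrite -[64%N]/(2 * (2 * (2 * (2 * (2 * 2)))))%N !exprM.
have [h0a ha] := sq _ _ (129/125) h0 h ltac:(lra).
have [h0b hb] := sq _ _ (131/123) h0a ha ltac:(lra).
have [h0c hc] := sq _ _ (2269/2000) h0b hb ltac:(lra).
have [h0d hd] := sq _ _ (103/80) h0c hc ltac:(lra).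
have [h0e he] := sq _ _ (829/500) h0d hd ltac:(lra).
by have [_ hf] := sq _ _ (11/4) h0e he ltac:(lra).
Qed.

Lemma euler5_le : euler ^+ 5 <= 158.
Proof.
apply: le_trans (_ : (11 / 4) ^+ 5 <= _); last by lra.
by rewrite lerXn2r ?nnegrE ?euler_le // ?(ltW euler_gt0) //; lra.
Qed.

Lemma pow_shift_le i t : ((i + t) ^ i)%:R <= (i ^ i)%:R * euler ^+ t.
Proof.
case: i => [|i]; first by rewrite !expn0 mul1r exprn_ege1 // euler_ge1.
have -> : (((i.+1 + t) ^ i.+1)%:R : R) = (i.+1 ^ i.+1)%:R * (1 + t%:R / i.+1%:R) ^+ i.+1.
  rewrite !natrX -exprMn; congr (_ ^+ _).
  by rewrite natrD mulrDr mulr1 mulrCA divff ?mulr1 // pnatr_eq0.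
have -> : euler ^+ t = expR (t%:R / i.+1%:R) ^+ i.+1.
  by rewrite -expR_nat -expRM_natl mulrC divfK // pnatr_eq0.
rewrite ler_wpM2l ?ler0n // lerXn2r ?nnegrE ?expR_ge0 ?expR_ge1Dx //.
Qed.

Lemma pow_le_fact i : (i ^ i)%:R <= (i`!)%:R * euler ^+ i.
Proof.
elim: i => [|i IH]; first by rewrite expn0 fact0 expr0 mulr1.
rewrite factS expnS !natrM -mulrA ler_wpM2l ?ler0n // exprSr mulrA.
apply: le_trans (_ : (i ^ i)%:R * euler <= _).
  by have := pow_shift_le i 1; rewrite addn1 expr1.
by rewrite ler_wpM2r // ltW // euler_gt0.
Qed.

(** Since 'C(2a - 1, a) <= 4^a and 'C(n, a) >= (n / a)^a, the left-hand side is at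
    most x^a with x = 4^5 (a / n)^3 <= 1/4; then a^3 <= 4^a. *)
Lemma small_set_term n a : (0 < a)%N -> (16 * a <= n)%N ->
  'C(n, a)%:R * 'C(n, a.-1)%:R * ('C(a + a.-1, a)%:R / 'C(n, a)%:R) ^+ 5
    <= 4 ^+ 6 / n%:R ^+ 3 :> R.
Proof.
move=> a0 an; have aln : (a <= n)%N by lia.
have n0 : (0 < n)%N by lia.
have C0 : 0 < ('C(n, a)%:R : R) by rewrite ltr0n bin_gt0.
have n0R : 0 < (n%:R : R) by rewrite ltr0n.
have h1 : ('C(n, a.-1)%:R : R) <= 'C(n, a)%:R.
  rewrite ler_nat; case: a a0 an {aln C0} => // a _ an /=.
  rewrite -(leq_pmul2l (ltn0Sn a)) mul_bin_left leq_mul2r; apply/orP; right; lia.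
have h2 : ('C(a + a.-1, a)%:R : R) <= 4 ^+ a.
  rewrite -natrX ler_nat; apply: leq_trans (bin_le_exp2 _ _) _.
  by rewrite -(expnM 2 2) leq_exp2l //; lia.
have h3 : (n%:R / a%:R) ^+ a <= ('C(n, a)%:R : R).
  rewrite exprMn exprVn ler_pdivrMr ?exprn_gt0 ?ltr0n // -!natrX -natrM ler_nat.
  exact: bin_ge_pow.
set C := ('C(n, a)%:R : R) in C0 h1 h3 *.
set x : R := 4 ^+ 5 * (a%:R / n%:R) ^+ 3.
have a0R : 0 < (a%:R : R) by rewrite ltr0n.
have x0 : 0 <= x by rewrite mulr_ge0 // exprn_ge0 // divr_ge0 ?ler0n.
have x4 : x <= 4^-1.
  have : a%:R / n%:R <= 16^-1 :> R.
    rewrite ler_pdivrMr //; have : (16 * a)%:R <= n%:R :> R by rewrite ler_nat.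
    by rewrite natrM; lra.
  have : 0 <= a%:R / n%:R :> R by rewrite divr_ge0 ?ler0n.
  rewrite /x; move: (a%:R / n%:R) => z z0 z1.
  suff : z ^+ 3 <= (16^-1) ^+ 3 by lra.
  by rewrite lerXn2r ?nnegrE //; lra.
have hx : x ^+ a <= 4 ^+ 6 / n%:R ^+ 3.
  rewrite -(prednK a0) exprS.
  apply: le_trans (_ : x * 4^-1 ^+ a.-1 <= _).
    by rewrite ler_wpM2l // lerXn2r ?nnegrE ?invr_ge0.
  have : (a ^ 3 <= 4 ^ a)%N.
    have base k : ((k.+4 ^ 3) <= 4 ^ k.+4)%N.
      elim: k => [|k IH] //; rewrite [X in (_ <= X)%N]expnS; nia.
    by case: (a) => [|[|[|[|k]]]] //; exact: base.
  rewrite -(ler_nat R) !natrX => h.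
  have E4 : (4 : R) ^+ a = 4 * 4 ^+ a.-1 by rewrite -exprS prednK.
  rewrite E4 in h.
  have p4 : 0 < (4 : R) ^+ a.-1 by rewrite exprn_gt0.
  have -> : x * 4^-1 ^+ a.-1 = (4 ^+ 5 * a%:R ^+ 3 / 4 ^+ a.-1) / n%:R ^+ 3.
    by rewrite /x expr_div_n exprVn; ring.
  rewrite ler_wpM2r ?invr_ge0 ?exprn_ge0 ?ler0n // ler_pdivrMr //; lra.
apply: le_trans hx.
have Ci : 0 <= C^-1 by rewrite invr_ge0 ltW.
apply: le_trans (_ : C * C * (4 ^+ a / C) ^+ 5 <= _).
  have u : C * 'C(n, a.-1)%:R <= C * C by rewrite ler_wpM2l // ltW.
  have v : ('C(a + a.-1, a)%:R / C) ^+ 5 <= (4 ^+ a / C) ^+ 5.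
    by rewrite lerXn2r ?nnegrE ?mulr_ge0 ?exprn_ge0 ?ler0n // ler_wpM2r.
  by apply: ler_pM u v; rewrite ?exprn_ge0 // mulr_ge0 ?ler0n // ltW.
have -> : C * C * (4 ^+ a / C) ^+ 5 = (4 ^+ a) ^+ 5 * (C^-1) ^+ 3.
  by field; rewrite gt_eqF.
have -> : x ^+ a = (4 ^+ a) ^+ 5 * (((n%:R / a%:R) ^+ a)^-1) ^+ 3.
  rewrite /x -!exprVn -!exprM (mulnC a 5) (mulnC a 3) !exprM -exprMn; congr (_ ^+ a).
  by field; rewrite !gt_eqF.
rewrite ler_wpM2l ?exprn_ge0 // lerXn2r ?nnegrE ?invr_ge0 ?exprn_ge0 ?divr_ge0 ?ler0n //.
by rewrite lef_pV2 ?posrE // exprn_gt0 // divr_gt0.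
Qed.

Lemma bin_fraction_le n q : (0 < q)%N ->
  ('C(n, n %/ q)%:R : R) <= (4 * q%:R) ^+ (n %/ q) * 4.
Proof.
move=> q0; set b := (n %/ q)%N.
have bn : (b <= n)%N by rewrite leq_div.
have q0R : 0 < (q%:R : R) by rewrite ltr0n.
have h := bin_tilt q 1 bn; rewrite exp1n muln1 addn1 in h.
have hR : 'C(n, b)%:R * q%:R ^+ n <= (q.+1%:R : R) ^+ n * q%:R ^+ b.
  have : ('C(n, b)%:R * q%:R ^+ (n - b) : R) <= q.+1%:R ^+ n.
    by rewrite -!natrX -natrM ler_nat.
  move/(ler_wpM2r (exprn_ge0 b (ler0n R q))).
  by rewrite -mulrA -exprD subnK.
have p : 0 < (q%:R : R) ^+ n by rewrite exprn_gt0.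
move: hR; rewrite -ler_pdivlMr // => /le_trans; apply.
have -> : (q.+1%:R : R) ^+ n * q%:R ^+ b / q%:R ^+ n = (1 + q%:R^-1) ^+ n * q%:R ^+ b.
  rewrite mulrAC -expr_div_n; congr (_ ^+ _ * _).
  by rewrite -addn1 natrD mulrDl divff ?gt_eqF // mul1r.
have i0 : 0 <= (q%:R^-1 : R) by rewrite invr_ge0 ltW.
have -> : (4 * q%:R : R) ^+ b * 4 = 4 ^+ b.+1 * q%:R ^+ b by rewrite exprMn exprSr mulrAC.
rewrite ler_wpM2r ?exprn_ge0 ?ler0n //.
apply: le_trans (_ : (1 + q%:R^-1) ^+ (q * b.+1) <= _).
  by rewrite ler_weXn2l ?lerDl // mulnC ltnW // ltn_ceil.
rewrite exprM lerXn2r ?nnegrE ?exprn_ge0 ?addr_ge0 //.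
apply: le_trans (_ : expR (q%:R^-1 : R) ^+ q <= _).
  by rewrite lerXn2r ?nnegrE ?expR_ge0 ?expR_ge1Dx // addr_ge0.
rewrite -expRM_natl divff ?gt_eqF //.
by apply: le_trans euler_le _; lra.
Qed.

(** The left-hand side is at most 'C(n, b)^6 / 'C(n, a)^4 with b = n / 512,
    and 'C(n, b)^6 is about 2^(66b) while 'C(n, a)^4 >= 2^(4a) >= 2^(128b). *)
Lemma medium_set_term n a : (n < 16 * a)%N -> (2 * a <= n)%N ->
  'C(n, a)%:R * 'C(n, n %/ 512)%:R * ('C(a + n %/ 512, a)%:R / 'C(n, a)%:R) ^+ 5
    <= 4 ^+ 6 / 2 ^+ (n %/ 512) :> R.
Proof.
move=> na an; set b := (n %/ 512)%N.
have bn : (512 * b <= n)%N by rewrite mulnC leq_trunc_div.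
have hb : ('C(n, b)%:R : R) <= 2 ^+ (11 * b + 2).
  apply: le_trans (bin_fraction_le n (ltn0Sn _)) _; rewrite -/b exprD exprM.
  have -> : (2 : R) ^+ 11 = 4 * 512%:R by lra.
  by have -> : (2 : R) ^+ 2 = 4 by lra.
have C0 : 0 < ('C(n, a)%:R : R) by rewrite ltr0n bin_gt0; lia.
have a0 : (0 < a)%N by lia.
have h1 : ('C(a + b, a)%:R : R) <= 'C(n, b)%:R.
  rewrite ler_nat -bin_sub ?leq_addr // addKn; apply: leq_bin2l; lia.
have h2 : (2 : R) ^+ a <= 'C(n, a)%:R.
  rewrite -natrX ler_nat -(leq_pmul2r (_ : 0 < a ^ a)%N) ?expn_gt0 ?a0 // -expnMn.
  by apply: leq_trans (bin_ge_pow _); [rewrite leq_exp2r | lia].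
set C := ('C(n, a)%:R : R) in C0 h2 *; set B := ('C(n, b)%:R : R) in hb h1 *.
have Ci : 0 <= C^-1 by rewrite invr_ge0 ltW.
apply: le_trans (_ : C * B * (B / C) ^+ 5 <= _).
  rewrite ler_wpM2l ?mulr_ge0 ?ler0n // ?(ltW C0) //.
  by rewrite lerXn2r ?nnegrE ?mulr_ge0 ?ler0n // ler_wpM2r.
have -> : C * B * (B / C) ^+ 5 = B ^+ 6 / C ^+ 4 by field; rewrite gt_eqF.
rewrite ler_pdivrMr ?exprn_gt0 // mulrAC ler_pdivlMr ?exprn_gt0 //.
apply: le_trans (_ : (2 ^+ (11 * b + 2)) ^+ 6 * 2 ^+ b <= _).
  by rewrite ler_wpM2r ?exprn_ge0 // lerXn2r ?nnegrE ?exprn_ge0 ?ler0n.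
apply: le_trans (_ : 4 ^+ 6 * (2 ^+ a) ^+ 4 <= _); last first.
  by rewrite ler_wpM2l // lerXn2r ?nnegrE ?exprn_ge0 // ltW.
have -> : (4 : R) ^+ 6 = 2 ^+ 12 by lra.
rewrite -!exprM -!exprD ler_weXn2l //; first by lra.
by lia.
Qed.

(** This and [tilt_sixth] bound x^p (1 - x)^(1 - p) by its maximum, for the
    two weights p = 1/2 and p = 1/6. *)
Lemma tilt_half x : x * (1 - x) <= 4^-1.
Proof. by have := sqr_ge0 (x - 2^-1); rewrite expr2; lra. Qed.

Lemma tilt_sixth x : 0 <= x <= 1 -> x * (1 - x) ^+ 5 <= 5 ^+ 5 / 6 ^+ 6.
Proof.
move=> /andP[x0 x1]; have [y y0 ->] : exists2 y, 0 <= y & x = 1 - y.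
  by exists (1 - x); lra.
rewrite subKr.
have q0 : 0 <= y ^+ 4 + 2 / 3 * y ^+ 3 + 5 / 12 * y ^+ 2 + 25 / 108 * y + 125 / 1296.
  by have := exprn_ge0 2 y0; have := exprn_ge0 3 y0; have := exprn_ge0 4 y0; lra.
rewrite -subr_ge0.
have -> : 5 ^+ 5 / 6 ^+ 6 - (1 - y) * y ^+ 5 = (y - 5 / 6) ^+ 2 *
   (y ^+ 4 + 2 / 3 * y ^+ 3 + 5 / 12 * y ^+ 2 + 25 / 108 * y + 125 / 1296) by field.
by rewrite mulr_ge0 // sqr_ge0.
Qed.

(** The left-hand side is log-convex in i, so only the ends n / 6 and n / 2 of
    the range matter.  Concretely, its fourth power is rewritten with the
    exponents u = n - 2i and w = 6i - n, for which 4i = u + w and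
    2n = 3u + w, and the two tilts bound the factors: the base of u is the
    value at n / 6, and the base of w, 3 e^5 / 2^9, the value at n / 2. *)
Lemma entropy_bound n i : (n <= 6 * i)%N -> (2 * i <= n)%N -> (0 < n)%N ->
  3 ^+ (n - i) / 2 ^+ i * (euler ^+ 5) ^+ i
    * ((i%:R / n%:R) ^+ i * (1 - i%:R / n%:R) ^+ (n - i)) ^+ 4 <= (14 / 15 : R) ^+ i.
Proof.
move=> n6 n2 n0.
have n0R : 0 < (n%:R : R) by rewrite ltr0n.
have x01 : 0 <= (i%:R / n%:R : R) <= 1.
  by rewrite divr_ge0 ?ler0n //= ler_pdivrMr // mul1r ler_nat; lia.
move: (i%:R / n%:R) x01 => x x01; have /andP[x0 x1] := x01.
have y0 : 0 <= 1 - x by lra.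
set z := x ^+ i * _; pose u := (n - 2 * i)%N; pose w := (6 * i - n)%N.
have z0 : 0 <= z by rewrite mulr_ge0 // exprn_ge0.
have z4 : z ^+ 4 <= (5 ^+ 5 / 6 ^+ 6) ^+ u * 4^-1 ^+ w.
  have -> : z ^+ 4 = (x * (1 - x) ^+ 5) ^+ u * (x * (1 - x)) ^+ w.
    rewrite /z !exprMn -!exprM mulrACA -!exprD.
    by congr (_ ^+ _ * _ ^+ _); rewrite /u /w; lia.
  apply: ler_pM; rewrite ?exprn_ge0 ?mulr_ge0 ?exprn_ge0 //.
    by rewrite lerXn2r ?nnegrE ?tilt_sixth // ?mulr_ge0 ?exprn_ge0 // ?divr_ge0 ?exprn_ge0.
  by rewrite lerXn2r ?nnegrE ?tilt_half // ?mulr_ge0 // invr_ge0.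
have E0 : 0 <= euler ^+ 5 by rewrite exprn_ge0 // ltW // euler_gt0.
have EE := euler5_le; move: (euler ^+ 5) E0 EE => E E0 EE.
have L0 : 0 <= 3 ^+ (n - i) / 2 ^+ i * E ^+ i * z ^+ 4.
  by rewrite !mulr_ge0 ?invr_ge0 ?exprn_ge0.
have T0 : 0 <= (14 / 15 : R) by lra.
rewrite -(@ler_pXn2r _ 4) ?nnegrE ?exprn_ge0 //.
have -> : (3 ^+ (n - i) / 2 ^+ i * E ^+ i * z ^+ 4) ^+ 4
   = (3 ^+ 5 * (E / 2)) ^+ u * (3 * (E / 2)) ^+ w * (z ^+ 4) ^+ 4.
  have -> : 3 ^+ (n - i) / 2 ^+ i * E ^+ i = 3 ^+ (n - i) * (E / 2) ^+ i.
    by rewrite exprMn exprVn mulrA mulrAC.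
  rewrite exprMn; congr (_ * _); move: (E / 2) => h.
  rewrite !exprMn -!exprM mulrACA -!exprD.
  by congr (_ ^+ _ * _ ^+ _); rewrite /u /w; lia.
apply: le_trans (_ : (3 ^+ 5 * (E / 2)) ^+ u * (3 * (E / 2)) ^+ w
    * ((5 ^+ 5 / 6 ^+ 6) ^+ u * 4^-1 ^+ w) ^+ 4 <= _).
  rewrite ler_wpM2l ?mulr_ge0 ?exprn_ge0 ?mulr_ge0 ?divr_ge0 ?exprn_ge0 //.
  by rewrite lerXn2r ?nnegrE ?mulr_ge0 ?exprn_ge0 ?mulr_ge0 ?divr_ge0 ?exprn_ge0.
have -> : (3 ^+ 5 * (E / 2)) ^+ u * (3 * (E / 2)) ^+ w
    * ((5 ^+ 5 / 6 ^+ 6) ^+ u * 4^-1 ^+ w) ^+ 4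
  = (3 ^+ 5 * (E / 2) * (5 ^+ 5 / 6 ^+ 6) ^+ 4) ^+ u * (3 * (E / 2) * 4^-1 ^+ 4) ^+ w.
  rewrite [(_ * 4^-1 ^+ w) ^+ 4]exprMn mulrACA -!exprM (mulnC u 4) (mulnC w 4) !exprM.
  by rewrite -!exprMn.
have -> : ((14 / 15 : R) ^+ i) ^+ 4 = (14 / 15) ^+ u * (14 / 15) ^+ w.
  by rewrite -exprM -exprD; congr (_ ^+ _); rewrite /u /w; lia.
apply: ler_pM; rewrite ?exprn_ge0 ?mulr_ge0 ?divr_ge0 ?exprn_ge0 ?invr_ge0 //.
  rewrite lerXn2r ?nnegrE ?mulr_ge0 ?divr_ge0 ?exprn_ge0 //; lra.
rewrite lerXn2r ?nnegrE ?mulr_ge0 ?divr_ge0 ?exprn_ge0 ?invr_ge0 //; lra.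
Qed.

(** For i <= n / 6 the crude bound 'C(n, i) >= 6^i suffices, as e^5 < 6^3.
    For larger i, 'C(n - i, i) <= 3^(n - i) / 2^i, which is sharp at
    i = 2n / 5, leads to [entropy_bound]. *)
Lemma indep_core n i m : (0 < i)%N -> (2 * i + 3 * m <= n)%N -> (n <= 4 ^ 5 * i)%N ->
  'C(n - i, i + 3 * m)%:R * (euler ^+ 5) ^+ i / 'C(n, i)%:R ^+ 4
    <= (4 ^+ 5) ^+ (3 * m) * n.+1%:R ^+ 4 * (14 / 15 : R) ^+ i.
Proof.
move=> i0 im ni; have n0 : (0 < n)%N by lia.
have iln : (i <= n)%N by lia.
have C0 : 0 < ('C(n, i)%:R : R) by rewrite ltr0n bin_gt0.
have e0 : 0 <= euler by rewrite ltW // euler_gt0.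
have E0 : 0 <= euler ^+ 5 by rewrite exprn_ge0.
have q1 : 1 <= ((4 ^+ 5) ^+ (3 * m) : R).
  by rewrite exprn_ege1 // exprn_ege1 //; lra.
have n1 : 1 <= (n.+1%:R ^+ 4 : R) by rewrite exprn_ege1 // ler1n.
have T0 : 0 <= (14 / 15 : R) ^+ i by rewrite exprn_ge0 //; lra.
case: (leqP (6 * i) n) => [n6|/ltnW n6].
  have hB : ('C(n - i, i + 3 * m)%:R : R) <= 'C(n, i)%:R * (4 ^+ 5) ^+ (3 * m).
    rewrite -!natrX -natrM ler_nat.
    by apply: leq_trans (leq_bin2l _ (leq_subr _ _)) _; apply: bin_shift.
  have hC : (6 : R) ^+ i <= 'C(n, i)%:R.
    rewrite -natrX ler_nat -(leq_pmul2r (_ : 0 < i ^ i)%N) ?expn_gt0 ?i0 // -expnMn.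
    by apply: leq_trans (bin_ge_pow _); rewrite ?leq_exp2r //; lia.
  move: C0 hB hC; move: ('C(n, i)%:R) ('C(n - i, _)%:R) => C B C0 hB hC.
  rewrite ler_pdivrMr ?exprn_gt0 //.
  apply: le_trans (_ : C * (4 ^+ 5) ^+ (3 * m) * (euler ^+ 5) ^+ i <= _).
    by rewrite ler_wpM2r // exprn_ge0.
  apply: le_trans (_ : (4 ^+ 5) ^+ (3 * m) * 1 * (14 / 15) ^+ i * C ^+ 4 <= _); last first.
    by rewrite ler_wpM2r ?exprn_ge0 ?(ltW C0) // ler_wpM2r // ler_wpM2l.
  rewrite [C * _]mulrC mulr1 -!mulrA ler_wpM2l ?exprn_ge0 //.
  rewrite [C ^+ 4]exprS mulrCA ler_wpM2l ?(ltW C0) //.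
  apply: le_trans (_ : (14 / 15) ^+ i * (6 ^+ i) ^+ 3 <= _); last first.
    by rewrite ler_wpM2l // lerXn2r ?nnegrE ?exprn_ge0 // ltW.
  rewrite [6 ^+ i ^+ 3]exprAC -exprMn lerXn2r ?nnegrE ?mulr_ge0 ?exprn_ge0 ?ler0n //.
  by apply: le_trans euler5_le _; lra.
have hB : ('C(n - i, i + 3 * m)%:R : R) <= 3 ^+ (n - i) / 2 ^+ i.
  rewrite ler_pdivlMr ?exprn_gt0 // -!natrX -natrM ler_nat.
  apply: leq_trans (_ : 'C(n - i, i + 3 * m)
    * (1 ^ (n - i - (i + 3 * m)) * 2 ^ (i + 3 * m)) <= _)%N.
    by rewrite exp1n mul1n leq_mul2l leq_exp2l // leq_addr orbT.
  by apply: (@bin_tilt _ _ 1 2); lia.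
have hC : ('C(n, i)%:R : R)^-1 <= n.+1%:R * ((i%:R / n%:R) ^+ i * (1 - i%:R / n%:R) ^+ (n - i)).
  rewrite -[leLHS]mul1r ler_pdivrMr //.
  have n0R : 0 < (n%:R : R) by rewrite ltr0n.
  have -> : 1 - i%:R / n%:R = (n - i)%:R / n%:R :> R.
    by rewrite natrB // mulrBl divff ?gt_eqF.
  rewrite !expr_div_n mulrACA -invfM -exprD subnKC // -!mulrA.
  rewrite [_^-1 * _]mulrC !mulrA ler_pdivlMr ?exprn_gt0 // mul1r.
  have := bin_max_term iln; rewrite -(ler_nat R) !natrM !natrX.
  move/le_trans; apply; rewrite le_eqVlt; apply/orP; left; apply/eqP.
  by move: (i%:R ^+ i) ((n - i)%:R ^+ (n - i)) => v w; ring.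
have := entropy_bound n6 _ n0; rewrite (_ : (2 * i <= n)%N); last by lia.
move=> /(_ isT); set z := _ * (1 - _) ^+ _; rewrite -/z in hC => hz.
apply: le_trans (_ : 3 ^+ (n - i) / 2 ^+ i * (euler ^+ 5) ^+ i * (n.+1%:R * z) ^+ 4 <= _).
  rewrite -exprVn; apply: ler_pM; rewrite ?mulr_ge0 ?exprn_ge0 ?invr_ge0 ?ler0n //.
    by rewrite ler_wpM2r // exprn_ge0.
  by rewrite lerXn2r ?nnegrE ?invr_ge0 ?ler0n // (le_trans _ hC) // invr_ge0 ler0n.
rewrite [(n.+1%:R * z) ^+ 4]exprMn mulrCA mulrC [leRHS]mulrC.
apply: le_trans (_ : (14 / 15) ^+ i * n.+1%:R ^+ 4 <= _).
  by rewrite ler_wpM2r ?exprn_ge0 ?ler0n.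
by rewrite ler_wpM2l // ler_peMl // exprn_ge0 ?ler0n.
Qed.

(** Enlarging the neighbourhood from i to i + 3m costs a factor C^m with
    C <= 2^52, and the gain (14 / 15)^i compensates for it because
    (14 / 15)^11 <= 1/2. *)
Lemma indep_term n i m : (0 < i)%N -> (2 * i + 3 * m <= n)%N -> (n <= 4 ^ 5 * i)%N ->
  (11 * 53 * m <= i)%N ->
  'C(n, i)%:R * 'C(n - i, i + 3 * m)%:R * (((i + 3 * m).+1 ^ i)%:R / (n ^_ i)%:R) ^+ 5
    <= 158 * n.+1%:R ^+ 4 / 2 ^+ m :> R.
Proof.
move=> i0 im ni mi; have := indep_core i0 im ni.
have iln : (i <= n)%N by lia.
have C0 : 0 < ('C(n, i)%:R : R) by rewrite ltr0n bin_gt0.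
have F0 : 0 < ((i`!)%:R : R) by rewrite ltr0n fact_gt0.
have e0 := euler_gt0.
have : ((i + 3 * m).+1 ^ i)%:R / (n ^_ i)%:R <= euler ^+ (i + (3 * m).+1) / 'C(n, i)%:R.
  rewrite -bin_ffact natrM invfM [_^-1 * _]mulrC mulrA ler_wpM2r ?invr_ge0 ?(ltW C0) //.
  rewrite ler_pdivrMr // -addnS exprD.
  apply: le_trans (pow_shift_le _ _) _.
  rewrite [leRHS]mulrC mulrA ler_wpM2r ?exprn_ge0 ?(ltW e0) //.
  exact: pow_le_fact.
have : 0 <= ((i + 3 * m).+1 ^ i)%:R / (n ^_ i)%:R :> R by rewrite divr_ge0 ?ler0n.
move: (_ / (n ^_ i)%:R) => r r0 hr.
have B0 : 0 <= ('C(n - i, i + 3 * m)%:R : R) by rewrite ler0n.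
move: C0 hr B0; move: ('C(n, i)%:R) ('C(n - i, _)%:R) => C B C0 hr B0 core.
apply: le_trans (_ : C * B * (euler ^+ (i + (3 * m).+1) / C) ^+ 5 <= _).
  rewrite ler_wpM2l ?mulr_ge0 // ?(ltW C0) // lerXn2r ?nnegrE //.
  by rewrite divr_ge0 ?exprn_ge0 ?ltW.
have -> : C * B * (euler ^+ (i + (3 * m).+1) / C) ^+ 5
   = B * (euler ^+ 5) ^+ i / C ^+ 4 * (euler ^+ 5) ^+ (3 * m).+1.
  rewrite exprD [euler ^+ 5 ^+ i]exprAC [euler ^+ 5 ^+ _]exprAC.
  move: (euler ^+ i) (euler ^+ (3 * m).+1) => v w.
  by field; rewrite gt_eqF.
have E0 : 0 <= euler ^+ 5 by rewrite exprn_ge0 // ltW.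
apply: le_trans (ler_wpM2r _ core) _; first by rewrite exprn_ge0.
apply: le_trans (_ : (4 ^+ 5) ^+ (3 * m) * n.+1%:R ^+ 4 * (14 / 15) ^+ i * 158 ^+ (3 * m).+1 <= _).
  rewrite ler_wpM2l ?mulr_ge0 ?exprn_ge0 ?ler0n //.
  by rewrite lerXn2r ?nnegrE ?euler5_le.
suff H : (4 ^+ 5) ^+ (3 * m) * 158 ^+ (3 * m) * (14 / 15) ^+ i <= (2 ^+ m)^-1 :> R.
  have -> : (4 ^+ 5) ^+ (3 * m) * n.+1%:R ^+ 4 * (14 / 15) ^+ i * 158 ^+ (3 * m).+1
    = 158 * n.+1%:R ^+ 4 * ((4 ^+ 5) ^+ (3 * m) * 158 ^+ (3 * m) * (14 / 15) ^+ i) :> R.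
    by rewrite [158 ^+ _.+1]exprS; ring.
  by rewrite ler_wpM2l // mulr_ge0 ?exprn_ge0 ?ler0n.
rewrite -exprMn exprM.
apply: le_trans (_ : (2 ^+ 52) ^+ m * (2^-1 ^+ 53) ^+ m <= _).
  apply: ler_pM; rewrite ?exprn_ge0 ?mulr_ge0 ?exprn_ge0 //.
    rewrite lerXn2r ?nnegrE ?mulr_ge0 ?exprn_ge0 //; last by lra.
  apply: le_trans (_ : (14 / 15) ^+ (11 * 53 * m) <= _).
    by rewrite ler_wiXn2l //; lra.
  rewrite exprM exprM lerXn2r ?nnegrE ?exprn_ge0 ?invr_ge0 //; try lra.
rewrite -!exprM exprVn ler_pdivrMr ?exprn_gt0 // mulrC ler_pdivlMr ?exprn_gt0 //.
by rewrite -exprD (_ : (52 * m + m)%N = (53 * m)%N) //; lia.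
Qed.
End Estimates.

(** * Four improbable events *)

Section SetSums.
Variable R : realType.
Implicit Types n a k : nat.

Lemma sum_by_card n (h : nat -> R) :
  \sum_(A : {set 'I_n}) h #|A| = \sum_(a < n.+1) 'C(n, a)%:R * h a.
Proof.
have An (A : {set 'I_n}) : (#|A| < n.+1)%N by rewrite ltnS -[leqRHS]card_ord max_card.
rewrite (partition_big (fun A : {set 'I_n} => Ordinal (An A)) predT) //=.
apply: eq_bigr => a _; rewrite (eq_bigr (fun=> h a)); last by move=> A /eqP <-.
rewrite sumr_const -[LHS]mulr_natl; congr (_%:R * _).
rewrite -[X in 'C(X, _)]card_ord -card_draws cardsE; apply: eq_card => A.
by [].
Qed.

Lemma sum_set_pairs n (D : pred nat) (f : nat -> nat) (g : nat -> R) :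
  \sum_(p : {set 'I_n} * {set 'I_n} |
      [&& D #|p.1|, [disjoint p.1 & p.2] & #|p.2| == f #|p.1|]) g #|p.1|
  = \sum_(a < n.+1 | D a) 'C(n, a)%:R * 'C(n - a, f a)%:R * g a.
Proof.
transitivity (\sum_(A : {set 'I_n}) (if D #|A| then 'C(n - #|A|, f #|A|)%:R * g #|A| else 0)).
  rewrite (eq_bigl (fun p : {set 'I_n} * {set 'I_n} =>
     true && (D #|p.1| && ([disjoint p.1 & p.2] && (#|p.2| == f #|p.1|))))) //.
  rewrite -(pair_big_dep predT
    (fun A B : {set 'I_n} => D #|A| && ([disjoint A & B] && (#|B| == f #|A|)))
    (fun A _ => g #|A|)) /=.
  apply: eq_bigr => A _; case: (D #|A|); last by rewrite big_pred0.
  rewrite sumr_const -[LHS]mulr_natl; congr (_%:R * _).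
  have -> : (n - #|A|)%N = #|~: A| by rewrite [RHS]cardsCs setCK card_ord.
  rewrite -cards_draws cardsE; apply: eq_card => B; rewrite -!topredE /=.
  by rewrite disjoint_sym disjoints_subset.
rewrite (sum_by_card n (fun a => if D a then 'C(n - a, f a)%:R * g a else 0)).
rewrite [RHS]big_mkcond; apply: eq_bigr => a _.
by case: (D a); rewrite ?mulr0 ?mulrA.
Qed.

(** The union bound over pairs (A, B) of prescribed sizes. *)
Lemma prob_pair_event n (E : pred (ua_choices n 5)) (D : pred nat) (f : nat -> nat)
    (X : {set 'I_n} -> {set 'I_n} -> {set 'I_n}) (g : nat -> R) (K : R) :
  (forall c, E c -> exists A B : {set 'I_n},
     [/\ D #|A|, [disjoint A & B], #|B| = f #|A| & nbr_sub c A (X A B)]) ->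
  (forall A B : {set 'I_n}, [disjoint A & B] -> #|B| = f #|A| ->
     ua_prob R (fun c : ua_choices n 5 => nbr_sub c A (X A B)) <= g #|A|) ->
  (forall a, D a -> (a <= n)%N -> 'C(n, a)%:R * 'C(n - a, f a)%:R * g a <= K) ->
  0 <= K -> ua_prob R E <= n.+1%:R * K.
Proof.
move=> EX PX gK K0.
apply: le_trans (_ : \sum_(p : {set 'I_n} * {set 'I_n} |
      [&& D #|p.1|, [disjoint p.1 & p.2] & #|p.2| == f #|p.1|])
   ua_prob R (fun c : ua_choices n 5 => nbr_sub c p.1 (X p.1 p.2)) <= _).
  apply: ua_prob_union => c /EX[A [B [DA dAB cB cAB]]].
  by exists (A, B); rewrite //= DA dAB cB eqxx.
apply: le_trans (_ : \sum_(p : {set 'I_n} * {set 'I_n} |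
      [&& D #|p.1|, [disjoint p.1 & p.2] & #|p.2| == f #|p.1|]) g #|p.1| <= _).
  by apply: ler_sum => -[A B] /and3P[/= _ dAB /eqP cB]; exact: PX.
rewrite sum_set_pairs big_mkcond /=.
apply: le_trans (_ : \sum_(a < n.+1) K <= _); last by rewrite sumr_const card_ord mulr_natl.
by apply: ler_sum => a _; case: ifP => // Da; apply: gK => //; rewrite -ltnS.
Qed.
End SetSums.

Section BadEvents.
Variable R : realType.
Implicit Types n m M : nat.

Definition small_trap n (c : ua_choices n 5) : bool :=
  [exists A : {set 'I_n}, exists B : {set 'I_n},
    [&& 0 < #|A|, 16 * #|A| <= n, [disjoint A & B], #|B| == #|A|.-1
      & nbr_sub c A (A :|: B)]]%N.

Definition medium_trap n (c : ua_choices n 5) : bool :=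
  [exists A : {set 'I_n}, exists B : {set 'I_n},
    [&& n < 16 * #|A|, 2 * #|A| <= n, [disjoint A & B], #|B| == n %/ 512
      & nbr_sub c A (A :|: B)]]%N.

(** The sizes i of an independent set to which [indep_term] applies. *)
Definition indep_range n m i : bool :=
  [&& 0 < i, 2 * i + 3 * m <= n, n <= 4 ^ 5 * i & 11 * 53 * m <= i]%N.

Definition indep_trap n m (c : ua_choices n 5) : bool :=
  [exists A : {set 'I_n}, exists B : {set 'I_n},
    [&& indep_range n m #|A|, [disjoint A & B], #|B| == #|A| + 3 * m
      & nbr_sub c A B]]%N.

Definition young_small n m M (D : {set 'I_n}) : bool :=
  (#|D| <= M)%N && [forall v in D, m <= v]%N.

(** With at least |D| edges, counted with multiplicity, the graph induced on D
    has a cycle or a multiple edge; for small D this is rare. *)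
Definition cyclic_set n (c : ua_choices n 5) (D : {set 'I_n}) : bool :=
  (#|D| <= #|inner_slots c D|)%N.

Definition many_cyclic n m M (c : ua_choices n 5) : bool :=
  (m <= #|[set D : {set 'I_n} | young_small m M D && cyclic_set c D]|)%N.

Lemma prob_small_trap n : (0 < n)%N ->
  ua_prob R (@small_trap n) <= n.+1%:R * (4 ^+ 6 / n%:R ^+ 3).
Proof.
move=> n0; apply: (prob_pair_event (D := fun a => (0 < a)%N && (16 * a <= n)%N)
   (f := predn) (X := fun A B => A :|: B)
   (g := fun a => ('C(a + a.-1, a)%:R / 'C(n, a)%:R) ^+ 5)).
- move=> c /existsP[A /existsP[B /and5P[A0 An dAB /eqP cB cAB]]].
  by exists A, B; rewrite A0 An.
- by move=> A B dAB cB; rewrite -cB; exact: prob_closed.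
- move=> a /andP[a0 an] _; apply: le_trans (small_set_term _ a0 an).
  rewrite ler_wpM2r ?exprn_ge0 ?divr_ge0 ?ler0n // ler_wpM2l ?ler0n // ler_nat.
  by rewrite leq_bin2l // leq_subr.
- by rewrite divr_ge0 ?exprn_ge0 ?ler0n.
Qed.

Lemma prob_medium_trap n : (0 < n)%N ->
  ua_prob R (@medium_trap n) <= n.+1%:R * (4 ^+ 6 / 2 ^+ (n %/ 512)).
Proof.
move=> n0; apply: (prob_pair_event (D := fun a => (n < 16 * a)%N && (2 * a <= n)%N)
   (f := fun=> (n %/ 512)%N) (X := fun A B => A :|: B)
   (g := fun a => ('C(a + n %/ 512, a)%:R / 'C(n, a)%:R) ^+ 5)).
- move=> c /existsP[A /existsP[B /and5P[A0 An dAB /eqP cB cAB]]].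
  by exists A, B; rewrite A0 An.
- by move=> A B dAB cB; rewrite -cB; exact: prob_closed.
- move=> a /andP[a0 an] _; apply: le_trans (medium_set_term _ a0 an).
  rewrite ler_wpM2r ?exprn_ge0 ?divr_ge0 ?ler0n // ler_wpM2l ?ler0n // ler_nat.
  by rewrite leq_bin2l // leq_subr.
- by rewrite divr_ge0 ?exprn_ge0 ?ler0n.
Qed.

Lemma prob_indep_trap n m : (0 < n)%N ->
  ua_prob R (@indep_trap n m) <= n.+1%:R * (158 * n.+1%:R ^+ 4 / 2 ^+ m).
Proof.
move=> n0; apply: (prob_pair_event (D := indep_range n m)
   (f := fun i => (i + 3 * m)%N) (X := fun A B => B)
   (g := fun i => (((i + 3 * m).+1 ^ i)%:R / (n ^_ i)%:R) ^+ 5)).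
- move=> c /existsP[A /existsP[B /and4P[DA dAB /eqP cB cAB]]].
  by exists A, B.
- by move=> A B dAB cB; rewrite -cB; exact: prob_indep.
- by move=> i /and4P[i0 im ni mi] _; exact: indep_term.
- by rewrite divr_ge0 ?mulr_ge0 ?exprn_ge0 ?ler0n.
Qed.

Lemma card_young_slots n k (D : {set 'I_n}) :
  (#|[set s : 'I_n.-1 * 'I_k | younger s.1 \in D]| <= #|D| * k)%N.
Proof.
rewrite (_ : [set s | _] = setX [set j | younger j \in D] [set: 'I_k]); last first.
  by apply/setP => -[j i]; rewrite !inE andbT.
rewrite cardsX cardsT card_ord leq_mul2r; apply/orP; right.
rewrite -(card_imset _ (_ : injective (@younger n))); last first.
  by move=> j j' /(congr1 val) [] /ord_inj.
by apply: subset_leq_card; apply/subsetP => _ /imsetP[j /[!inE] jD ->].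
Qed.

(** Each of the at most 2^(5|D|) sets of |D| choices stays inside D with
    probability at most (M / m)^|D|, as the choosing vertices are not among
    the m oldest. *)
Lemma prob_cyclic_set n m M (D : {set 'I_n}) : (0 < m)%N -> young_small m M D ->
  ua_prob R (fun c : ua_choices n 5 => cyclic_set c D) <= (32 * M%:R / m%:R) ^+ #|D|.
Proof.
move=> m0 /andP[DM /forall_inP Dm].
set Sl := [set s : 'I_n.-1 * 'I_5 | younger s.1 \in D].
have SlD : (#|Sl| <= #|D| * 5)%N by exact: card_young_slots.
have m0R : 0 < (m%:R : R) by rewrite ltr0n.
apply: le_trans (_ : \sum_(T : {set 'I_n.-1 * 'I_5} | (T \subset Sl) && (#|T| == #|D|))
    ua_prob R (fun c : ua_choices n 5 => T \subset inner_slots c D) <= _).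
  apply: ua_prob_union => c; rewrite /cyclic_set => leD.
  have /set0Pn[T] : [set T : {set _} | T \subset inner_slots c D & #|T| == #|D|] != set0.
    by rewrite -card_gt0 cards_draws bin_gt0.
  rewrite inE => /andP[TI TD]; exists T => //; rewrite TD andbT.
  by apply: subset_trans TI _; apply/subsetP => s; rewrite !inE => /andP[].
apply: le_trans (_ : \sum_(T : {set 'I_n.-1 * 'I_5} | (T \subset Sl) && (#|T| == #|D|))
    (M%:R / m%:R) ^+ #|D| <= _).
  apply: ler_sum => T /andP[/subsetP TS /eqP TD].
  apply: le_trans (prob_inner_slots R D (m := m) m0 _) _.
    by move=> s /TS; rewrite inE => /Dm.
  rewrite TD lerXn2r ?nnegrE ?divr_ge0 ?ler0n //.
  by rewrite ler_wpM2r ?invr_ge0 ?ler0n // ler_nat.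
rewrite sumr_const -[leLHS]mulr_natl -[32 * _ / _]mulrA [leRHS]exprMn.
rewrite ler_wpM2r ?exprn_ge0 ?divr_ge0 ?ler0n //.
have -> : #|[pred T : {set 'I_n.-1 * 'I_5} | (T \subset Sl) && (#|T| == #|D|)]|
   = 'C(#|Sl|, #|D|).
  by rewrite -cards_draws cardsE.
apply: le_trans (_ : (2 ^ (#|D| * 5))%:R <= _).
  by rewrite ler_nat; apply: leq_trans (bin_le_exp2 _ _) _; rewrite leq_exp2l.
by rewrite mulnC expnM natrX.
Qed.

(** Markov's inequality: the expected number of such cyclic sets is bounded
    independently of n, as 'C(n, a) <= n^a and n / m is bounded. *)
Lemma prob_many_cyclic n m M : (0 < m)%N -> (0 < M)%N -> (n <= 2 * M * m)%N ->
  ua_prob R (@many_cyclic n m M) <= M.+1%:R * (64 * M%:R ^+ 2) ^+ M / m%:R.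
Proof.
move=> m0 M0 nM; have m0R : 0 < (m%:R : R) by rewrite ltr0n.
rewrite ler_pdivlMr //.
apply: le_trans (_ : \sum_(D : {set 'I_n} | young_small m M D)
   ua_prob R (fun c : ua_choices n 5 => cyclic_set c D) <= _).
  rewrite [leRHS](eq_bigr (fun D => \sum_c (if cyclic_set c D then ua_mass R c else 0)));
    last by move=> D _; rewrite /ua_prob big_mkcond.
  rewrite exchange_big /ua_prob big_distrl /= big_mkcond /=; apply: ler_sum => c _.
  have pos D : 0 <= (if cyclic_set c D then ua_mass R c else 0).
    by case: ifP => // _; exact: ua_mass_ge0.
  case: ifP => [mc|_]; last exact: sumr_ge0.
  rewrite -big_mkcondr /= sumr_const -[leRHS]mulr_natr ler_wpM2l ?ua_mass_ge0 // ler_nat.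
  by move: mc; rewrite /many_cyclic cardsE.
set q : R := 32 * M%:R / m%:R.
apply: le_trans (_ : \sum_(D : {set 'I_n}) (if (#|D| <= M)%N then q ^+ #|D| else 0) <= _).
  rewrite big_mkcond /=; apply: ler_sum => D _.
  have q0 : 0 <= q by rewrite divr_ge0 ?mulr_ge0 ?ler0n.
  case: ifP => [yD|_]; last by case: ifP => // _; exact: exprn_ge0.
  by have /andP[-> _] := yD; exact: prob_cyclic_set.
rewrite (sum_by_card n (fun a => if (a <= M)%N then q ^+ a else 0)).
have q0 : 0 <= q by rewrite divr_ge0 ?mulr_ge0 ?ler0n.
have Q1 : 1 <= 64 * (M%:R : R) ^+ 2.
  have : 1 <= (M%:R : R) ^+ 2 by rewrite exprn_ege1 // ler1n.
  by lra.
apply: le_trans (_ : \sum_(a < n.+1 | (a < M.+1)%N) (64 * M%:R ^+ 2) ^+ M <= _).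
  rewrite [leRHS]big_mkcond; apply: ler_sum => a _; rewrite ltnS.
  case: ifP => aM; last by rewrite mulr0.
  apply: le_trans (_ : (n%:R * q) ^+ a <= _).
    rewrite [leRHS]exprMn ler_wpM2r ?exprn_ge0 // -natrX ler_nat.
    apply: leq_trans (_ : n ^_ a <= _)%N.
      by rewrite -bin_ffact leq_pmulr // fact_gt0.
    elim: (nat_of_ord a) {aM} => [|k IH]; first by rewrite ffactn0.
    by rewrite ffactnSr expnSr leq_mul // leq_subr.
  apply: le_trans (_ : (64 * M%:R ^+ 2) ^+ a <= _); last exact: ler_weXn2l.
  rewrite lerXn2r ?nnegrE ?mulr_ge0 ?exprn_ge0 ?ler0n //.
  rewrite /q mulrA ler_pdivrMr //.
  apply: le_trans (_ : (2 * M * m)%:R * (32 * M%:R) <= _).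
    by rewrite ler_wpM2r ?mulr_ge0 ?ler0n // ler_nat.
  by rewrite !natrM; nra.
rewrite sumr_const -[leLHS]mulr_natl ler_wpM2r ?exprn_ge0 ?mulr_ge0 ?ler0n // ler_nat.
rewrite -[leqRHS]card_ord.
have inj : {in [pred a : 'I_n.+1 | (a < M.+1)%N] &,
    injective (fun a : 'I_n.+1 => inord a : 'I_M.+1)}.
  by move=> a b aM bM /(congr1 val); rewrite /= !inordK // => /ord_inj.
by rewrite -(card_in_image inj) max_card.
Qed.
End BadEvents.

(** * Graphs without a perfect matching contain a trap *)

Section Deterministic.
Local Open Scope nat_scope.

Lemma subset_of_card (T : finType) (X : {set T}) k : k <= #|X| ->
  exists2 Y : {set T}, Y \subset X & #|Y| = k.
Proof.
move=> kX; have /set0Pn[Y] : [set Y : {set T} | Y \subset X & #|Y| == k] != set0.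
  by rewrite -card_gt0 cards_draws bin_gt0.
by rewrite inE => /andP[YX /eqP Yk]; exists Y.
Qed.

Lemma enlarge_in (T : finType) (S X : {set T}) k : S \subset X -> #|S| <= k -> k <= #|X| ->
  exists B : {set T}, [/\ S \subset B, B \subset X & #|B| = k].
Proof.
move=> SX Sk kX.
have kXS : k - #|S| <= #|X :\: S| by rewrite cardsD (setIidPr SX) leq_sub2r.
have [Y YX Yk] := subset_of_card kXS.
exists (S :|: Y); split; first exact: subsetUl.
  by rewrite subUset SX (subset_trans YX) // subsetDl.
rewrite cardsU (_ : S :&: Y = set0) ?cards0 ?Yk; first by lia.
apply/eqP; rewrite setI_eq0 disjoint_sym; apply: disjointWl YX _.
by rewrite disjoints_subset subsetDr.
Qed.

(** The ordered adjacent pairs in D number at least 2|D|, and each choice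
    inside D accounts for two of them. *)
Lemma cyclic_of_two_neighbours n (c : ua_choices n 5) (D : {set 'I_n}) :
  (forall v, v \in D -> exists x y, [/\ x != y, x \in D, y \in D
     & ua_adj c v x && ua_adj c v y]) -> cyclic_set c D.
Proof.
move=> H; rewrite /cyclic_set.
pose Ar := [set p : 'I_n * 'I_n | [&& p.1 \in D, p.2 \in D & ua_adj c p.1 p.2]].
have geA : 2 * #|D| <= #|Ar|.
  have -> : #|Ar| = \sum_(v in D) #|[set x in D | ua_adj c v x]|.
    rewrite -sum1_card (eq_bigl (fun p : 'I_n * 'I_n =>
      (p.1 \in D) && ((p.2 \in D) && ua_adj c p.1 p.2)));
      last by move=> p; rewrite inE.
    rewrite -(pair_big_dep (mem D) (fun v x => (x \in D) && ua_adj c v x) (fun _ _ => 1)) /=.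
    by apply: eq_bigr => v _; rewrite -sum1_card; apply: eq_bigl => x; rewrite inE.
  rewrite mulnC -sum_nat_const; apply: leq_sum => v /H[x [y [xy xD yD /andP[vx vy]]]].
  apply: leq_trans (_ : #|[set x; y]| <= _); first by rewrite cards2 xy.
  apply: subset_leq_card.
  by apply/subsetP => z; rewrite !inE => /orP[]/eqP->; rewrite ?xD ?vx ?yD ?vy.
pose h1 (s : 'I_n.-1 * 'I_5) := (younger s.1, older c s.1 s.2).
pose h2 (s : 'I_n.-1 * 'I_5) := (older c s.1 s.2, younger s.1).
have leA : #|Ar| <= #|inner_slots c D| + #|inner_slots c D|.
  apply: leq_trans (leq_add (leq_imset_card h1 _) (leq_imset_card h2 _)).
  apply: leq_trans (_ : #|(h1 @: inner_slots c D) :|: (h2 @: inner_slots c D)| <= _);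
    last by rewrite cardsU leq_subr.
  apply: subset_leq_card; apply/subsetP => -[u v]; rewrite inE /= => /and3P[uD vD].
  move=> /existsP[j /existsP[i /orP[]/andP[/eqP e1 /eqP e2]]]; rewrite inE; apply/orP.
    have yu : younger j = u by apply: val_inj.
    have ov : older c j i = v by apply: val_inj.
    by left; apply/imsetP; exists (j, i); rewrite ?inE /= /h1 /= ?yu ?ov ?uD.
  have yu : younger j = v by apply: val_inj.
  have ov : older c j i = u by apply: val_inj.
  by right; apply/imsetP; exists (j, i); rewrite ?inE /= /h2 /= ?yu ?ov ?uD ?vD.
lia.
Qed.

Section Cases.
Variables (n : nat) (c : ua_choices n 5) (S : {set 'I_n}) (P : {set {set 'I_n}}).
Hypothesis partP : partition P (~: S).
Hypothesis manyP : #|S| + 2 <= #|P|.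
Hypothesis closedP : forall D u v, D \in P -> u \in D -> v \notin S -> ua_adj c u v -> v \in D.

Let covP : cover P = ~: S. Proof. by case/and3P: partP => /eqP. Qed.
Let trivP : trivIset P. Proof. by case/and3P: partP. Qed.
Let P0 D : D \in P -> D != set0.
Proof. by move=> DP; apply: contraTneq DP => ->; case/and3P: partP. Qed.

Lemma union_trap (Q : {set {set 'I_n}}) (B : {set 'I_n}) : Q \subset P -> S \subset B ->
  nbr_sub c (cover Q) (cover Q :|: B).
Proof.
move=> QP SB; apply/forall_inP => u /bigcupP[D DQ uD]; apply/forallP => v; apply/implyP => uv.
rewrite inE; case: (boolP (v \in S)) => [/(subsetP SB)->|vS]; first by rewrite orbT.
apply/orP; left; apply/bigcupP; exists D => //.
exact: closedP (subsetP QP _ DQ) uD vS uv.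
Qed.

(** A largest union of classes with at most n / 2 elements.  If it has less
    than n / 4 elements, every class outside it has more than n / 2 elements,
    so that there is at most one such class. *)
Lemma balanced_union : #|S| < n %/ 512 ->
  exists Q : {set {set 'I_n}}, [/\ Q \subset P, 2 * #|cover Q| <= n, 0 < #|cover Q|
    & (n < 4 * #|cover Q| + 1) || (#|S| + 1 <= #|cover Q|)].
Proof.
move=> Sb.
pose ok (Q : {set {set 'I_n}}) := (Q \subset P) && (2 * #|cover Q| <= n).
have ok0 : ok set0 by rewrite /ok sub0set /cover big_set0 cards0.
have [Q [QP Qn Qmax]] : exists Q : {set {set 'I_n}}, [/\ Q \subset P, 2 * #|cover Q| <= n
    & forall Q', ok Q' -> #|cover Q'| <= #|cover Q|].
  have [Q /andP[QP Qn] Qmax] := arg_maxnP (fun Q : {set {set 'I_n}} => #|cover Q|) ok0.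
  by exists Q.
have n0 : 0 < n.
  by have b0 := leq_ltn_trans (leq0n _) Sb; apply: leq_trans b0 (leq_div _ _).
have subtriv (Q' : {set {set 'I_n}}) : Q' \subset P -> #|cover Q'| = \sum_(D in Q') #|D|.
  by move=> Q'P; apply/esym/eqP/(trivIsetS Q'P).
suff H : (n < 4 * #|cover Q| + 1) || (#|S| + 1 <= #|cover Q|).
  by exists Q; split=> //; move: H; lia.
case: (ltnP n (4 * #|cover Q| + 1)) => //= small.
have big D : D \in P :\: Q -> n < 2 * #|D|.
  rewrite inE => /andP[DnQ DP]; rewrite ltnNge; apply/negP => Dn.
  have D0 : 0 < #|D| by rewrite card_gt0 P0.
  have DQP : D |: Q \subset P by rewrite subUset sub1set DP.
  have cDQ : #|cover (D |: Q)| = #|D| + #|cover Q|.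
    by rewrite !subtriv // big_setU1.
  have h1 : 2 * #|cover (D |: Q)| <= n -> #|D| + #|cover Q| <= #|cover Q|.
    by move=> h; rewrite -cDQ; apply: Qmax; rewrite /ok DQP.
  have c1 : cover [set D] = D by rewrite /cover big_set1.
  have h2 : #|D| <= #|cover Q|.
    by rewrite -{1}c1; apply: Qmax; rewrite /ok c1 sub1set DP.
  move: D0 h2 small Dn h1; rewrite cDQ.
  by move: (#|D|) (#|cover Q|) => d q d0 dq qn dn /(_ ltac:(lia)); lia.
have few : #|P :\: Q| <= 1.
  rewrite leqNgt; apply/negP => /card_gt1P[D [D' [DPQ D'PQ DD']]].
  have [/setDP[DP _] /setDP[D'P _]] := (DPQ, D'PQ).
  have dis : [disjoint D & D'] by apply: (trivIsetP trivP).
  have := cardsU D D'; rewrite (disjoint_setI0 dis) cards0 subn0 => cDD'.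
  have : #|D :|: D'| <= n by rewrite -[leqRHS]card_ord max_card.
  by move: (big _ DPQ) (big _ D'PQ); lia.
have QC : #|Q| <= #|cover Q|.
  rewrite subtriv // -sum1_card; apply: leq_sum => D DQ.
  by rewrite card_gt0 P0 // (subsetP QP).
have : #|P| = #|Q| + #|P :\: Q| by rewrite -(cardsID Q P) (setIidPr QP).
move=> cP; move: manyP few QC; rewrite {}cP.
by move: (#|S|) (#|Q|) (#|P :\: Q|) (#|cover Q|) => s q d u; lia.
Qed.

Lemma small_barrier : #|S| < n %/ 512 -> small_trap c || medium_trap c.
Proof.
move=> Sb; have [Q [QP Qn Q0 QS]] := balanced_union Sb.
set A := cover Q in Qn Q0 QS *.
have SA : S \subset ~: A.
  apply/subsetP => v vS; rewrite inE; apply/negP => /bigcupP[D DQ vD].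
  have : v \in cover P by apply/bigcupP; exists D => //; exact: (subsetP QP).
  by rewrite covP inE vS.
have cA : #|~: A| = n - #|A| by rewrite [LHS]cardsCs setCK card_ord.
have b512 : 512 * (n %/ 512) <= n by rewrite mulnC leq_trunc_div.
have disB (B : {set 'I_n}) : B \subset ~: A -> [disjoint A & B].
  by move=> BA; rewrite disjoint_sym disjoints_subset.
case: (leqP (16 * #|A|) n) => An.
  have [||B [SB BA cB]] := @enlarge_in _ S (~: A) #|A|.-1 SA.
  - by move: QS; lia.
  - by rewrite cA; lia.
  apply/orP; left; apply/existsP; exists A; apply/existsP; exists B.
  by rewrite Q0 An disB //= cB eqxx /=; exact: union_trap.
have [||B [SB BA cB]] := @enlarge_in _ S (~: A) (n %/ 512) SA.
- exact: ltnW.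
- by rewrite cA; lia.
apply/orP; right; apply/existsP; exists A; apply/existsP; exists B.
by rewrite An Qn disB //= cB eqxx /=; exact: union_trap.
Qed.
Hypothesis twoP : forall D v, D \in P -> 1 < #|D| -> v \in D ->
  exists x y, [/\ x != y, x \in D, y \in D & ua_adj c v x && ua_adj c v y].
Variables (m M : nat).
Hypothesis Mbig : 512 * 586 <= M.
Hypothesis mE : m = n %/ M.
Hypothesis m0 : 0 < m.

Let Mm : M * m <= n. Proof. by rewrite mE mulnC leq_trunc_div. Qed.
Let bm : 586 * m <= n %/ 512.
Proof.
rewrite leq_divRL // mulnC mulnA.
exact: leq_trans (leq_mul Mbig (leqnn m)) Mm.
Qed.

(** At most m classes contain one of the m oldest vertices, at most n / M have
    more than M elements, and the remaining ones are cyclic. *)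
Lemma card_nonsingleton : ~~ many_cyclic m M c ->
  #|[set D in P | 1 < #|D|]| <= 3 * m.
Proof.
move=> nmany.
pose Old := [set D in P | [exists v in D, v < m]].
pose Big := [set D in P | M < #|D|].
pose Cyc := [set D : {set 'I_n} | young_small m M D && cyclic_set c D].
have cOld : #|Old| <= m.
  apply: leq_trans (_ : #|(pblock P) @: [set v : 'I_n | v < m]| <= _).
    apply: subset_leq_card; apply/subsetP => D; rewrite inE => /andP[DP /exists_inP[v vD vm]].
    by apply/imsetP; exists v; rewrite ?inE // (def_pblock trivP DP vD).
  apply: leq_trans (leq_imset_card _ _) _.
  case: (posnP m) => [|m1]; first by move: m0; case: m.
  rewrite -[leqRHS](card_ord m).
  have inj : {in [set v : 'I_n | v < m] &,
      injective (fun v : 'I_n => insubd (Ordinal m1) (v : nat) : 'I_m)}.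
    move=> u v; rewrite !inE => um vm /(congr1 val).
    by rewrite /= !val_insubd um vm => /ord_inj.
  by rewrite -(card_in_imset inj) max_card.
have cBig : #|Big| <= m.
  rewrite mE leq_divRL; last by lia.
  rewrite -sum_nat_const; apply: leq_trans (_ : \sum_(D in Big) #|D| <= _).
    by apply: leq_sum => D; rewrite inE => /andP[_ /ltnW].
  apply: leq_trans (_ : \sum_(D in P) #|D| <= _).
    rewrite [leqRHS](bigID (mem Big)) /= (eq_bigl (fun D => (D \in P) && (D \in Big))).
      by rewrite leq_addr.
    by move=> D; rewrite !inE; case: (D \in P).
  by rewrite -(card_partition partP) -[leqRHS]card_ord max_card.
have cCyc : #|Cyc| < m by rewrite ltnNge.
apply: leq_trans (_ : #|Old :|: Big :|: Cyc| <= _).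
  apply: subset_leq_card; apply/subsetP => D; rewrite !inE => /andP[DP D1].
  rewrite DP /=; case: (ltnP M #|D|) => [|DM]; first by rewrite orbT.
  case: (boolP [exists v in D, v < m]) => [//|/exists_inPn old].
  rewrite orbF /=; apply/andP; split; last by apply: cyclic_of_two_neighbours => v; exact: twoP.
  by rewrite /young_small DM; apply/forall_inP => v /old; rewrite -leqNgt.
apply: leq_trans (_ : #|Old| + #|Big| + #|Cyc| <= _); last by lia.
apply: leq_trans (leq_card_setU _ _) _; rewrite leq_add2r; exact: leq_card_setU.
Qed.

Lemma large_barrier : n %/ 512 <= #|S| -> ~~ many_cyclic m M c -> indep_trap m c.
Proof.
move=> bS /card_nonsingleton nons.
pose Sing := [set v | [set v] \in P].
have cSing : #|S| - 3 * m <= #|Sing|.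
  have : #|P| <= #|Sing| + #|[set D in P | 1 < #|D|]|.
    rewrite -[#|Sing|](card_imset _ (@set1_inj _)).
    apply: leq_trans (leq_card_setU _ _).
    apply: subset_leq_card; apply/subsetP => D DP; rewrite !inE DP /=.
    case: (ltngtP 1 #|D|) => [||/esym/eqP/cards1P[v Dv]]; rewrite ?orbT ?orbF //.
      by rewrite ltnS leqn0 cards_eq0 (negbTE (P0 DP)).
    by rewrite Dv; apply: imset_f; rewrite inE -Dv.
  by move: nons manyP; lia.
have [A AS cA] := subset_of_card cSing.
have singP u : u \in A -> [set u] \in P by move=> /(subsetP AS); rewrite inE.
have dAS : [disjoint A & S].
  rewrite -setI_eq0; apply/eqP/setP => u; rewrite !inE; apply/negP => /andP[/singP uP uS].
  have : u \in cover P by apply/bigcupP; exists [set u]; rewrite ?inE.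
  by rewrite covP inE uS.
have cAS : #|A| + #|S| <= n.
  have := cardsU A S; rewrite (disjoint_setI0 dAS) cards0 subn0 => <-.
  by rewrite -[leqRHS]card_ord max_card.
have n512 : n < (n %/ 512).+1 * 512 by rewrite ltn_ceil.
apply/existsP; exists A; apply/existsP; exists S; apply/and4P; split=> //.
- by apply/and4P; split; move: cA cAS bS bm m0 n512; [lia | lia | | lia];
    rewrite (_ : 4 ^ 5 = 1024) //; lia.
- by apply/eqP; move: cA bS bm m0; lia.
apply/forall_inP => u /singP uP; apply/forallP => v; apply/implyP => uv.
apply/negPn/negP => vS; have := closedP uP (set11 u) vS uv.
by rewrite inE => /eqP vu; move: uv; rewrite vu ua_adj_irr.
Qed.

End Cases.

Lemma no_perfect_matching_trap n m M (c : ua_choices n 5) :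
  512 * 586 <= M -> m = n %/ M -> 0 < m -> ~~ has_perfect_matching (ua_adj c) ->
  [|| small_trap c, medium_trap c, indep_trap m c | many_cyclic m M c].
Proof.
move=> hM mE m0 /(gallai_partition (@ua_adj_sym _ _ c) (@ua_adj_irr _ _ c)).
move=> [S [P [partP manyP closedP twoP]]].
case: (ltnP #|S| (n %/ 512)) => hS.
  by have /orP[->|->] := small_barrier partP manyP closedP hS; rewrite ?orbT.
case: (boolP (many_cyclic m M c)) => [|ncyc]; first by rewrite !orbT.
by rewrite (large_barrier partP manyP closedP twoP hM mE m0 hS ncyc) !orbT.
Qed.
End Deterministic.

(** * The limit *)

Section Limit.
Variable R : realType.

Lemma ua_prob_le1 n k (E : pred (ua_choices n k)) : ua_prob R E <= 1.
Proof. by rewrite -(ua_prob_total R n k); exact: ua_prob_sub. Qed.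

Lemma ua_probC n k (E : pred (ua_choices n k)) :
  ua_prob R E = 1 - ua_prob R (fun c => ~~ E c).
Proof.
apply/eqP; rewrite eq_sym subr_eq -(ua_prob_total R n k) /ua_prob (bigID E) /=.
by rewrite eq_sym.
Qed.

Lemma double_quotient_bound n M : (0 < M)%N -> (0 < n %/ M)%N -> (n < 2 * M * (n %/ M))%N.
Proof.
move=> M0 q0; apply: leq_trans (ltn_ceil n M0) _.
by rewrite mulnAC leq_mul2r; apply/orP; right; lia.
Qed.

Lemma no_perfect_matching_prob_le n m M : (512 * 586 <= M)%N -> m = (n %/ M)%N -> (0 < m)%N ->
  ua_prob R (fun c : ua_choices n 5 => ~~ has_perfect_matching (ua_adj c))
  <= n.+1%:R * (4 ^+ 6 / n%:R ^+ 3) + n.+1%:R * (4 ^+ 6 / 2 ^+ m)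
     + n.+1%:R * (158 * n.+1%:R ^+ 4 / 2 ^+ m) + M.+1%:R * (64 * M%:R ^+ 2) ^+ M / m%:R.
Proof.
move=> hM mE m0.
have M0 : (0 < M)%N by apply: leq_trans hM.
have Mm : (m * M <= n)%N by rewrite mE leq_trunc_div.
have n0 : (0 < n)%N by apply: leq_trans Mm; rewrite muln_gt0 m0.
have nM : (n <= 2 * M * m)%N by rewrite mE ltnW // double_quotient_bound // -mE.
have mb : (m <= n %/ 512)%N by rewrite mE leq_div2l //; apply: leq_trans hM; rewrite leq_pmulr.
pose F (k : 'I_4) (c : ua_choices n 5) : bool :=
  nth false [:: small_trap c; medium_trap c; indep_trap m c; many_cyclic m M c] k.
apply: le_trans (_ : \sum_(k < 4) ua_prob R (F k) <= _).
  apply: ua_prob_union => c /(no_perfect_matching_trap hM mE m0).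
  have [k3 k2 k1 k0] : [/\ (3 < 4)%N, (2 < 4)%N, (1 < 4)%N & (0 < 4)%N] by [].
  by move=> /or4P[] h; [exists (Ordinal k0) | exists (Ordinal k1)
    | exists (Ordinal k2) | exists (Ordinal k3)].
rewrite !big_ord_recr big_ord0 /= add0r.
apply: lerD; last exact: prob_many_cyclic.
apply: lerD; last exact: prob_indep_trap.
apply: lerD; first exact: prob_small_trap.
apply: le_trans (prob_medium_trap R n0) _.
rewrite ler_wpM2l ?ler0n // ler_wpM2l ?exprn_ge0 //.
by rewrite lef_pV2 ?posrE ?exprn_gt0 // ler_weXn2l //; lra.
Qed.

(** The exponential beats the polynomial: (m + 1)^6 = O(2^m). *)
Lemma decay_le n m M : (0 < M)%N -> m = (n %/ M)%N -> (0 < m)%N ->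
  n.+1%:R ^+ 5 / 2 ^+ m <= M%:R ^+ 5 * (64 * 720)%N%:R / m%:R :> R.
Proof.
move=> M0 mE m0; have m0R : 0 < (m%:R : R) by rewrite ltr0n.
rewrite ler_pdivrMr ?exprn_gt0 // mulrAC ler_pdivlMr //.
have n1 : (n.+1 <= M * m.+1)%N by rewrite mulnC mE ltn_ceil.
apply: le_trans (_ : (M * m.+1)%:R ^+ 5 * m.+1%:R <= _).
  by rewrite ler_pM ?exprn_ge0 ?ler0n ?ler_nat // lerXn2r ?nnegrE ?ler0n ?ler_nat.
have -> : (M * m.+1)%:R ^+ 5 * m.+1%:R = M%:R ^+ 5 * (m.+1 ^ 6)%:R :> R.
  by rewrite natrX [(M * _)%:R]natrM [(_ * _) ^+ 5]exprMn -[LHS]mulrA -[_ * m.+1%:R]exprSr.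
rewrite -[leRHS]mulrA ler_wpM2l ?exprn_ge0 ?ler0n //.
by rewrite -natrX -natrM ler_nat; exact: pow6_le_exp2.
Qed.

Lemma no_perfect_matching_prob_decay : exists C : R, exists2 M, (0 < M)%N &
  forall n, (M <= n)%N ->
  ua_prob R (fun c : ua_choices n 5 => ~~ has_perfect_matching (ua_adj c)) <= C / n.+1%:R.
Proof.
have [M hM] : exists M, (512 * 586 <= M)%N.
  exists (512 * 586)%N; exact: leqnn.
have M0 : (0 < M)%N by apply: leq_trans hM.
have [K0 EK0] : exists K0 : R, M.+1%:R * (64 * M%:R ^+ 2) ^+ M = K0 by eexists.
have K0p : 0 <= K0 by rewrite -EK0 mulr_ge0 ?exprn_ge0 ?mulr_ge0 ?ler0n.
have [K1 EK1] : exists K1 : R, M%:R ^+ 5 * (64 * 720)%N%:R = K1 by eexists.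
have K1p : 0 <= K1 by rewrite -EK1 mulr_ge0 ?exprn_ge0 ?ler0n.
exists ((2 * 4 ^+ 6 + 4 ^+ 6 * K1 + 158 * K1 + K0) * (2 * M%:R)), M => // n Mn.
pose m := (n %/ M)%N.
have m0 : (0 < m)%N by rewrite divn_gt0.
have n0 : (0 < n)%N by apply: leq_trans Mn.
have m0R : 0 < (m%:R : R) by rewrite ltr0n.
apply: le_trans (no_perfect_matching_prob_le hM erefl m0) _; rewrite -/m EK0.
have dec := decay_le M0 (erefl m) m0; rewrite EK1 in dec.
have n1 : 1 <= (n.+1%:R : R) by rewrite ler1n.
apply: le_trans (_ : (2 * 4 ^+ 6 + 4 ^+ 6 * K1 + 158 * K1 + K0) / m%:R <= _); last first.
  rewrite -mulrA ler_wpM2l //.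
    by rewrite !addr_ge0 ?mulr_ge0 ?exprn_ge0.
  rewrite ler_pdivlMr ?ltr0n // mulrC ler_pdivrMr // -!natrM ler_nat mulnC.
  by rewrite mulnC; exact: double_quotient_bound.
rewrite (mulrDl _ K0) (mulrDl _ (158 * K1)) (mulrDl _ (4 ^+ 6 * K1)).
apply: lerD => //; apply: lerD; first (apply: lerD).
- rewrite mulrCA [2 * _]mulrC -[leRHS]mulrA ler_wpM2l ?exprn_ge0 //.
  rewrite ler_pdivrMr ?exprn_gt0 ?ltr0n // mulrAC ler_pdivlMr //.
  have mn : (m <= n)%N by rewrite leq_div.
  rewrite -!natrX -!natrM ler_nat.
  by rewrite !expnS expn0 muln1; nia.
- rewrite mulrCA -[leRHS]mulrA ler_wpM2l ?exprn_ge0 //; apply: le_trans dec.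
  by rewrite ler_wpM2r ?invr_ge0 ?exprn_ge0 // ler_eXnr.
rewrite -[158 * _ / _]mulrA mulrCA -[leRHS]mulrA ler_wpM2l //.
by rewrite mulrA -exprS.
Qed.
End Limit.

Local Open Scope classical_set_scope.

Unset Implicit Arguments.

Theorem theorem2p2 (R : realType) :
  (fun n : nat =>
     ua_prob R (fun c : ua_choices n 5 => has_perfect_matching (ua_adj c)))
    @ \oo --> (1 : R).
Proof.
have [C [M M0 HC]] := no_perfect_matching_prob_decay R.
apply: (@squeeze_cvgr _ _ _ _ (fun n : nat => 1 - C * n.+1%:R^-1) (fun=> 1)).
- near=> n; rewrite ua_prob_le1 andbT ua_probC lerD2l lerN2.
  by apply: HC; near: n; exact: nbhs_infty_ge.
- rewrite -[X in _ --> X]subr0 -[X in _ - X](mulr0 C).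
  by apply: cvgB; [exact: cvg_cst | apply: cvgMr; exact: cvg_harmonic].
- exact: cvg_cst.
Unshelve. all: by end_near.
Qed.
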